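(* Let $\omega$ be a weight on $\mathbb{Z}$ and let $f \in C(\Gamma)$ have $\omega$-absolutely convergent Fourier series. Let $\varphi$ be a function holomorphic on an open neighbourhood of the range $f(\Gamma)\subseteq\mathbb{C}$. Then there exists a weight $\chi$ on $\mathbb{Z}$ such that: (a) $\varphi\circ f$ has $\chi$-absolutely convergent Fourier series; (b) $\chi$ is non-constant if and only if $\omega$ is non-constant; (c) $\chi(n)\le\omega(n)$ for all $n\in\mathbb{Z}$.
   Context: $\Gamma=\{z\in\mathbb{C}:|z|=1\}$ is the unit circle and $C(\Gamma)$ the set of continuous complex-valued functions on $\Gamma$. For $f\in C(\Gamma)$ its Fourier coefficients are $\widehat f(n)=\frac{1}{2\pi}\int_{-\pi}^{\pi} f(e^{it})e^{-int}\,dt$, $n\in\mathbb{Z}$. A weight on $\mathbb{Z}$ is a map $\omega:\mathbb{Z}\to[1,\infty)$ with $\omega(m+n)\le\omega(m)\omega(n)$ for all $m,n\in\mathbb{Z}$. A function $f\in C(\Gamma)$ has $\omega$-absolutely convergent Fourier series if $\sum_{n\in\mathbb{Z}}|\widehat f(n)|\,\omega(n)<\infty$. *)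

(* Defs.v *)
From Stdlib Require Import Reals ZArith.
From Coquelicot Require Import Coquelicot.

Open Scope R_scope.

Definition is_weight (w : Z -> R) : Prop :=
  (forall n : Z, 1 <= w n) /\
  (forall m n : Z, w (m + n)%Z <= w m * w n).

Definition expi (t : R) : C := (cos t, sin t).

Definition on_circle (z : C) : Prop := Cmod z = 1.

Definition continuous_on_circle (f : C -> C) : Prop :=
  forall z, on_circle z ->
    forall eps : R, 0 < eps -> exists delta : R, 0 < delta /\
      forall w, on_circle w -> Cmod (w - z)%C < delta -> Cmod (f w - f z)%C < eps.

Definition CRInt (g : R -> C) (a b : R) : C :=
  (RInt (fun t => fst (g t)) a b, RInt (fun t => snd (g t)) a b).

Definition fourier (f : C -> C) (n : Z) : C :=
  (RtoC (/ (2 * PI)) *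
  CRInt (fun t => f (expi t) * expi (- (IZR n) * t)) (- PI) PI)%C.

(* summability over Z of a nonnegative family a : Z -> R, split into
   the nonnegative and negative indices *)
Definition summable_Z (a : Z -> R) : Prop :=
  ex_series (fun k : nat => a (Z.of_nat k)) /\
  ex_series (fun k : nat => a (- Z.of_nat k)%Z).

Definition w_abs_conv (w : Z -> R) (f : C -> C) : Prop :=
  summable_Z (fun n => Cmod (fourier f n) * w n).

Definition nonconstant (w : Z -> R) : Prop := exists m n : Z, w m <> w n.

Definition holo_near_range (phi f : C -> C) : Prop :=
  exists U : C -> Prop,
    open U /\
    (forall z, on_circle z -> U (f z)) /\
    (forall w, U w -> ex_derive (phi : C_AbsRing -> C_NormedModule) w).

(* Main.v *)
(** The weight [min (w n) K] is submultiplicative for every [K >= 1], and for a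
suitable [K] it is non-constant whenever [w] is. Being bounded, it reduces the
theorem to the unweighted Wiener-Levy theorem: if [F] has an absolutely convergent
Fourier series and [phi] is holomorphic near the range of [F], then [phi o F] has
one too.

For the latter, split [F = P + g] with [P] a trigonometric polynomial and [g] of small
Wiener norm, and expand [phi (P + g) = sum_k c_k(P) g^k] with the Taylor coefficients
of [phi] at the moving centre [P t]. A function [G] with
[|G (t + s) + G (t - s) - 2 G t| <= C s^2] has Fourier coefficients [O(1/n^2)]; the
second differences of [c_k(P)] are circle averages of those of [phi (P + rho character^(i th))],
hence bounded uniformly in [k] up to the factor [rho^-k], and the series converges in
Wiener norm.

Taylor expansions are obtained from Goursat's theorem in the coordinate
[log (z - a)]: the [n]-th Fourier coefficient of [phi] on the circle of radius [r]
around [a] is [r^n] times a constant, which vanishes for [n < 0]. *)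

Require Import Defs.
From Stdlib Require Import Reals ZArith Lra Lia Psatz List Classical ClassicalEpsilon FinFun FunctionalExtensionality.
From Coquelicot Require Import Coquelicot.

(** * Complex-valued functions of a real variable and their integrals *)

(** An expansion of [phi] at a fixed centre represents [phi o F] only while [F] stays near that
    centre, and patching several of them would need cut-off functions. Centring at [P t] gives one
    expansion valid for all [t]; the price is that the Taylor coefficients become functions of [t],
    whose Wiener norms may grow at most geometrically in [k]. Second differences control them
    through a sup bound of [phi] on discs alone. The decay [1/n^2] then comes from a shift by
    [pi/n], under which the [n]-th character changes sign. Geometric growth is affordable because
    the circles have radius [2 r] while [g] has Wiener norm at most [r], so the terms shrink like
    [2^-k]. Fourier series are never summed pointwise. The Wiener norm is handled as a bound on all
    finite sums of coefficients, and the Fejer kernel shows that it dominates the sup norm. That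
    inequality serves three times: for products, for the Taylor remainder, and to keep [P t] close
    to [F t]. *)

Definition ccont (F : R -> C) (t : R) : Prop :=
  continuous (fun x => fst (F x)) t /\ continuous (fun x => snd (F x)) t.

Lemma C_eq (a b : C) : fst a = fst b -> snd a = snd b -> a = b.
Proof. destruct a, b; simpl; intros -> ->; reflexivity. Qed.

Lemma Cmod_le_sum (z : C) : Cmod z <= Rabs (fst z) + Rabs (snd z).
Proof.
unfold Cmod. apply Rsqr_incr_0_var.
- rewrite Rsqr_sqrt by nra.
  rewrite <- (Rsqr_pow2 (fst z)), <- (Rsqr_pow2 (snd z)), (Rsqr_abs (fst z)), (Rsqr_abs (snd z)).
  pose proof (Rabs_pos (fst z)); pose proof (Rabs_pos (snd z)). unfold Rsqr; nra.
- pose proof (Rabs_pos (fst z)); pose proof (Rabs_pos (snd z)); lra.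
Qed.

Lemma fst_le_Cmod (z : C) : Rabs (fst z) <= Cmod z.
Proof. eapply Rle_trans; [apply Rmax_l | apply Rmax_Cmod]. Qed.

Lemma snd_le_Cmod (z : C) : Rabs (snd z) <= Cmod z.
Proof. eapply Rle_trans; [apply Rmax_r | apply Rmax_Cmod]. Qed.

Lemma continuous_eps (f : R -> R) (t : R) :
  continuous f t <->
  forall eps, 0 < eps -> exists del, 0 < del /\ forall s, Rabs (s - t) < del -> Rabs (f s - f t) < eps.
Proof.
split.
- intros H eps He.
  destruct (proj1 (filterlim_locally f (f t)) H (mkposreal eps He)) as [d Hd].
  exists d; split; [apply cond_pos|]. intros s Hs. exact (Hd s Hs).
- intros H. apply (proj2 (filterlim_locally f (f t))). intros eps.
  destruct (H eps (cond_pos eps)) as [d [Hd H']].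
  exists (mkposreal d Hd). intros s Hs. exact (H' s Hs).
Qed.

Lemma ccont_eps (F : R -> C) (t : R) :
  ccont F t <->
  forall eps, 0 < eps -> exists del, 0 < del /\ forall s, Rabs (s - t) < del -> Cmod (F s - F t) < eps.
Proof.
unfold ccont; rewrite 2!continuous_eps. split.
- intros [H1 H2] eps He.
  destruct (H1 (eps / 2) ltac:(lra)) as [d1 [Hd1 K1]].
  destruct (H2 (eps / 2) ltac:(lra)) as [d2 [Hd2 K2]].
  exists (Rmin d1 d2); split; [apply Rmin_pos; assumption|]. intros s Hs.
  eapply Rle_lt_trans; [apply Cmod_le_sum|].
  specialize (K1 s (Rlt_le_trans _ _ _ Hs (Rmin_l _ _))).
  specialize (K2 s (Rlt_le_trans _ _ _ Hs (Rmin_r _ _))).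
  simpl. unfold Rminus in K1, K2. lra.
- intros H; split; intros eps He; destruct (H eps He) as [d [Hd K]];
    exists d; split; auto; intros s Hs; eapply Rle_lt_trans; [|apply (K s Hs)| |apply (K s Hs)].
  + apply (fst_le_Cmod (F s - F t)%C).
  + apply (snd_le_Cmod (F s - F t)%C).
Qed.

Lemma ccont_const (c : C) (t : R) : ccont (fun _ => c) t.
Proof. split; apply continuous_const. Qed.

Lemma ccont_plus (F G : R -> C) (t : R) : ccont F t -> ccont G t -> ccont (fun x => F x + G x)%C t.
Proof. intros [? ?] [? ?]; split; simpl; apply (continuous_plus (V := R_NormedModule)); assumption. Qed.

Lemma ccont_minus (F G : R -> C) (t : R) : ccont F t -> ccont G t -> ccont (fun x => F x - G x)%C t.
Proof.
intros [? ?] [? ?]; split; simpl; apply (continuous_minus (V := R_NormedModule)); assumption.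
Qed.

Lemma ccont_mult (F G : R -> C) (t : R) : ccont F t -> ccont G t -> ccont (fun x => F x * G x)%C t.
Proof.
intros [? ?] [? ?]; split; simpl.
- apply (continuous_minus (V := R_NormedModule)); apply (continuous_mult (K := R_AbsRing)); assumption.
- apply (continuous_plus (V := R_NormedModule)); apply (continuous_mult (K := R_AbsRing)); assumption.
Qed.

Lemma ccont_comp (F : R -> C) (g : R -> R) (t : R) :
  continuous g t -> ccont F (g t) -> ccont (fun x => F (g x)) t.
Proof.
intros Hg [H1 H2]; split.
- apply (continuous_comp g (fun x => fst (F x))); assumption.
- apply (continuous_comp g (fun x => snd (F x))); assumption.
Qed.

Lemma ccont_expi (t : R) : ccont expi t.
Proof. split; simpl; [apply continuous_cos | apply continuous_sin]. Qed.

Lemma continuous_scal_id (a t : R) : continuous (fun x => a * x) t.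
Proof. apply (continuous_mult (K := R_AbsRing)); [apply continuous_const | apply continuous_id]. Qed.

Lemma ccont_expi_scal (a t : R) : ccont (fun x => expi (a * x)) t.
Proof. apply (ccont_comp expi); [apply continuous_scal_id | apply ccont_expi]. Qed.

Lemma expi_plus (a b : R) : expi (a + b) = (expi a * expi b)%C.
Proof. unfold expi; apply C_eq; simpl; [rewrite cos_plus | rewrite sin_plus]; ring. Qed.

Lemma expi_0 : expi 0 = 1%C.
Proof. unfold expi; rewrite cos_0, sin_0; reflexivity. Qed.

Lemma Cmod_expi (t : R) : Cmod (expi t) = 1.
Proof.
unfold Cmod, expi; simpl. rewrite 2!Rmult_1_r, Rplus_comm.
change (sqrt (Rsqr (sin t) + Rsqr (cos t)) = 1). rewrite sin2_cos2; apply sqrt_1.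
Qed.

Lemma expi_period (t : R) (k : Z) : expi (t + 2 * IZR k * PI) = expi t.
Proof.
assert (N : forall x (n : nat), expi (x + 2 * INR n * PI) = expi x).
{ intros x n; unfold expi; rewrite cos_period, sin_period; reflexivity. }
destruct (Z_le_gt_dec 0 k) as [H|H].
- rewrite <- (Z2Nat.id k H), <- INR_IZR_INZ; apply N.
- rewrite <- (N (t + 2 * IZR k * PI) (Z.to_nat (- k))). f_equal.
  rewrite INR_IZR_INZ, Z2Nat.id, opp_IZR by lia; ring.
Qed.

Definition integrable (F : R -> C) (a b : R) : Prop :=
  ex_RInt (fun t => fst (F t)) a b /\ ex_RInt (fun t => snd (F t)) a b.

Lemma ccont_integrable (F : R -> C) (a b : R) :
  (forall t, Rmin a b <= t <= Rmax a b -> ccont F t) -> integrable F a b.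
Proof. intros H; split; apply (ex_RInt_continuous (V := R_CompleteNormedModule)); intros z Hz; apply H; exact Hz. Qed.

Lemma CRInt_ext (F G : R -> C) (a b : R) : (forall t, F t = G t) -> CRInt F a b = CRInt G a b.
Proof. intros H; replace G with F; [reflexivity | apply functional_extensionality; assumption]. Qed.

Lemma CRInt_plus (F G : R -> C) (a b : R) : integrable F a b -> integrable G a b ->
  CRInt (fun t => F t + G t)%C a b = (CRInt F a b + CRInt G a b)%C.
Proof. intros [? ?] [? ?]; apply C_eq; simpl; apply (RInt_plus (V := R_CompleteNormedModule)); assumption. Qed.

Lemma CRInt_minus (F G : R -> C) (a b : R) : integrable F a b -> integrable G a b ->
  CRInt (fun t => F t - G t)%C a b = (CRInt F a b - CRInt G a b)%C.
Proof. intros [? ?] [? ?]; apply C_eq; simpl; apply (RInt_minus (V := R_CompleteNormedModule)); assumption. Qed.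

Lemma CRInt_scal (c : C) (F : R -> C) (a b : R) : integrable F a b ->
  CRInt (fun t => c * F t)%C a b = (c * CRInt F a b)%C.
Proof.
intros [H1 H2]; destruct c as [u v].
assert (E : forall k (f : R -> R), ex_RInt f a b -> RInt (fun t => k * f t) a b = k * RInt f a b)
  by (intros k f Hf; apply (RInt_scal (V := R_CompleteNormedModule)); assumption).
assert (E' : forall k (f : R -> R), ex_RInt f a b -> ex_RInt (fun t => k * f t) a b)
  by (intros k f Hf; apply (ex_RInt_scal (V := R_NormedModule)); assumption).
apply C_eq; simpl; rewrite <- !E by assumption.
- apply (RInt_minus (V := R_CompleteNormedModule)); auto.
- apply (RInt_plus (V := R_CompleteNormedModule)); auto.
Qed.

Lemma integrable_scal (c : C) (F : R -> C) (a b : R) : integrable F a b -> integrable (fun t => c * F t)%C a b.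
Proof.
intros [H1 H2]; destruct c as [u v].
assert (E' : forall k (f : R -> R), ex_RInt f a b -> ex_RInt (fun t => k * f t) a b)
  by (intros k f Hf; apply (ex_RInt_scal (V := R_NormedModule)); assumption).
split; simpl.
- apply (ex_RInt_minus (V := R_NormedModule)); auto.
- apply (ex_RInt_plus (V := R_NormedModule)); auto.
Qed.

Lemma integrable_plus (F G : R -> C) (a b : R) : integrable F a b -> integrable G a b ->
  integrable (fun t => F t + G t)%C a b.
Proof. intros [? ?] [? ?]; split; simpl; apply (ex_RInt_plus (V := R_NormedModule)); auto. Qed.

Lemma CRInt_const (c : C) (a b : R) : CRInt (fun _ => c) a b = (RtoC (b - a) * c)%C.
Proof. apply C_eq; simpl; rewrite RInt_const; unfold scal; simpl; unfold mult; simpl; ring. Qed.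

Lemma CRInt_Chasles (F : R -> C) (a b c : R) : integrable F a b -> integrable F b c ->
  (CRInt F a b + CRInt F b c)%C = CRInt F a c.
Proof. intros [? ?] [? ?]; apply C_eq; simpl; apply (RInt_Chasles (V := R_CompleteNormedModule)); assumption. Qed.

Lemma CRInt_shift (F : R -> C) (s a b : R) : integrable F (a + s) (b + s) ->
  CRInt (fun t => F (t + s)) a b = CRInt F (a + s) (b + s).
Proof.
intros [H1 H2].
assert (E : forall f : R -> R, ex_RInt f (a + s) (b + s) -> RInt (fun t => f (t + s)) a b = RInt f (a + s) (b + s)).
{ intros f Hf. pose proof (RInt_comp_lin (V := R_CompleteNormedModule) f 1 s a b) as K.
  rewrite !Rmult_1_l in K. rewrite <- (K Hf). apply RInt_ext; intros x _.
  unfold scal; simpl; unfold mult; simpl. rewrite 2!Rmult_1_l; reflexivity. }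
apply C_eq; [exact (E _ H1) | exact (E _ H2)].
Qed.
Lemma CRInt_norm (F : R -> C) (g : R -> R) (a b : R) : a <= b -> integrable F a b -> ex_RInt g a b ->
  (forall t, a <= t <= b -> Cmod (F t) <= g t) -> Cmod (CRInt F a b) <= RInt g a b.
Proof.
intros Hab [H1 H2] Hg H.
rewrite Cmod_norm.
apply (norm_RInt_le (V := C_R_NormedModule) F g a b (CRInt F a b) (RInt g a b) Hab).
- intros t Ht; specialize (H t Ht); rewrite Cmod_norm in H; exact H.
- apply (is_RInt_fct_extend_pair (U := R_NormedModule) (V := R_NormedModule));
    apply (RInt_correct (V := R_CompleteNormedModule)); assumption.
- apply (RInt_correct (V := R_CompleteNormedModule)); assumption.
Qed.

(** * Fourier coefficients of continuous periodic functions *)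

Definition percont (F : R -> C) : Prop := (forall t, ccont F t) /\ (forall t, F (t + 2 * PI) = F t).

Definition character (k : Z) (t : R) : C := expi (IZR k * t).

Definition mean (F : R -> C) : C := (RtoC (/ (2 * PI)) * CRInt F (- PI) PI)%C.

(** Spelled so that [fcoef (fun t => f (expi t)) n] is convertible with [fourier f n]; the passage
    to and from [w_abs_conv] relies on this. *)
Definition fcoef (F : R -> C) (n : Z) : C :=
  (RtoC (/ (2 * PI)) * CRInt (fun t => F t * expi (- (IZR n) * t)) (- PI) PI)%C.

Lemma fcoef_mean (F : R -> C) (n : Z) : fcoef F n = mean (fun t => F t * character (- n) t)%C.
Proof. unfold fcoef, mean, character; rewrite opp_IZR; reflexivity. Qed.

Lemma percont_const (c : C) : percont (fun _ => c).
Proof. split; [intros; apply ccont_const | reflexivity]. Qed.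

Lemma percont_plus (F G : R -> C) : percont F -> percont G -> percont (fun t => F t + G t)%C.
Proof. intros [H1 H2] [K1 K2]; split; intros t; [apply ccont_plus; auto | rewrite H2, K2; auto]. Qed.

Lemma percont_minus (F G : R -> C) : percont F -> percont G -> percont (fun t => F t - G t)%C.
Proof. intros [H1 H2] [K1 K2]; split; intros t; [apply ccont_minus; auto | rewrite H2, K2; auto]. Qed.

Lemma percont_mult (F G : R -> C) : percont F -> percont G -> percont (fun t => F t * G t)%C.
Proof. intros [H1 H2] [K1 K2]; split; intros t; [apply ccont_mult; auto | rewrite H2, K2; auto]. Qed.

Lemma percont_scal (c : C) (F : R -> C) : percont F -> percont (fun t => c * F t)%C.
Proof. intros H; apply percont_mult; [apply percont_const | exact H]. Qed.

Lemma percont_shift (F : R -> C) (s : R) : percont F -> percont (fun t => F (t + s)).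
Proof.
intros [H1 H2]; split; intros t.
- apply (ccont_comp F (fun x => x + s)); [|apply H1].
  apply (continuous_plus (V := R_NormedModule)); [apply continuous_id | apply continuous_const].
- replace (t + 2 * PI + s) with (t + s + 2 * PI) by ring; apply H2.
Qed.

Lemma percont_character (k : Z) : percont (character k).
Proof.
split; intros t; [apply ccont_expi_scal|].
unfold character; rewrite <- (expi_period (IZR k * t) k); f_equal; ring.
Qed.

Lemma character_mult (j k : Z) (t : R) : (character j t * character k t)%C = character (j + k) t.
Proof. unfold character; rewrite <- expi_plus, plus_IZR; f_equal; ring. Qed.

Lemma character_0 (t : R) : character 0 t = 1%C.
Proof. unfold character; rewrite Rmult_0_l; apply expi_0. Qed.

Lemma character_shift (k : Z) (t s : R) : character k (t + s) = (character k s * character k t)%C.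
Proof. unfold character; rewrite <- expi_plus; f_equal; ring. Qed.

Lemma Cmod_character (k : Z) (t : R) : Cmod (character k t) = 1.
Proof. apply Cmod_expi. Qed.

Lemma percont_integrable (F : R -> C) (a b : R) : percont F -> integrable F a b.
Proof. intros [H _]; apply ccont_integrable; auto. Qed.

Lemma per_Z (F : R -> C) : percont F -> forall (k : Z) t, F (t + 2 * IZR k * PI) = F t.
Proof.
intros [_ H] k t.
assert (N : forall (n : nat) x, F (x + 2 * INR n * PI) = F x).
{ induction n as [|n IH]; intros x.
  - simpl INR; f_equal; ring.
  - rewrite <- (IH x), <- (H (x + 2 * INR n * PI)). f_equal. rewrite S_INR; ring. }
destruct (Z_le_gt_dec 0 k) as [K|K].
- rewrite <- (Z2Nat.id k K), <- INR_IZR_INZ; apply N.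
- rewrite <- (N (Z.to_nat (- k)) (t + 2 * IZR k * PI)). f_equal.
  rewrite INR_IZR_INZ, Z2Nat.id, opp_IZR by lia; ring.
Qed.

Lemma period_reduce (t : R) : exists k : Z, - PI <= t + 2 * IZR k * PI <= PI.
Proof.
pose proof PI_RGT_0 as P.
(* The half makes [Int_part x] the integer nearest to [t / (2 pi)]. *)
set (x := t / (2 * PI) + / 2).
destruct (base_Int_part x) as [H1 H2].
exists (- Int_part x)%Z. rewrite opp_IZR.
assert (E : t = 2 * PI * (x - / 2)) by (unfold x; field; lra).
rewrite E. nra.
Qed.

Lemma percont_bounded (F : R -> C) : percont F -> exists B, forall t, Cmod (F t) <= B.
Proof.
intros HF.
destruct (bounded_continuity (V := R_NormedModule) (fun t => fst (F t)) (- PI) PI) as [M1 K1].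
{ intros x _; apply (proj1 HF). }
destruct (bounded_continuity (V := R_NormedModule) (fun t => snd (F t)) (- PI) PI) as [M2 K2].
{ intros x _; apply (proj1 HF). }
exists (M1 + M2). intros t. destruct (period_reduce t) as [k Hk].
rewrite <- (per_Z F HF k t).
eapply Rle_trans; [apply Cmod_le_sum|].
specialize (K1 _ Hk). specialize (K2 _ Hk).
unfold norm in K1, K2; simpl in K1, K2; unfold abs in K1, K2; simpl in K1, K2. lra.
Qed.

Lemma CRInt_period_shift (F : R -> C) (s : R) : percont F -> CRInt F (- PI + s) (PI + s) = CRInt F (- PI) PI.
Proof.
intros HF.
assert (E : CRInt F PI (PI + s) = CRInt F (- PI) (- PI + s)).
{ rewrite <- (CRInt_ext (fun t => F (t + 2 * PI)) F (- PI) (- PI + s)) by (intros; apply HF).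
  rewrite CRInt_shift by (apply percont_integrable; assumption).
  f_equal; ring. }
rewrite <- (CRInt_Chasles F (- PI + s) (- PI) (PI + s)) by (apply percont_integrable; assumption).
rewrite <- (CRInt_Chasles F (- PI) PI (PI + s)) by (apply percont_integrable; assumption).
rewrite E.
rewrite Cplus_comm, <- Cplus_assoc, (CRInt_Chasles F (- PI) (- PI + s) (- PI)) by (apply percont_integrable; assumption).
replace (CRInt F (- PI) (- PI)) with (RtoC 0); [ring|].
apply C_eq; simpl; rewrite RInt_point; reflexivity.
Qed.

Lemma mean_plus (F G : R -> C) : percont F -> percont G -> mean (fun t => F t + G t)%C = (mean F + mean G)%C.
Proof. intros; unfold mean; rewrite CRInt_plus by (apply percont_integrable; assumption); ring. Qed.

Lemma mean_minus (F G : R -> C) : percont F -> percont G -> mean (fun t => F t - G t)%C = (mean F - mean G)%C.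
Proof. intros; unfold mean; rewrite CRInt_minus by (apply percont_integrable; assumption); ring. Qed.

Lemma mean_scal (c : C) (F : R -> C) : percont F -> mean (fun t => c * F t)%C = (c * mean F)%C.
Proof. intros; unfold mean; rewrite CRInt_scal by (apply percont_integrable; assumption); ring. Qed.

Lemma mean_const (c : C) : mean (fun _ => c) = c.
Proof.
unfold mean; rewrite CRInt_const, Cmult_assoc, <- RtoC_mult.
replace (/ (2 * PI) * (PI - - PI)) with 1 by (field; pose proof PI_RGT_0; lra). ring.
Qed.

Lemma mean_ext (F G : R -> C) : (forall t, F t = G t) -> mean F = mean G.
Proof. intros H; unfold mean; rewrite (CRInt_ext F G) by assumption; reflexivity. Qed.

Lemma mean_shift (F : R -> C) (s : R) : percont F -> mean (fun t => F (t + s)) = mean F.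
Proof.
intros H; unfold mean; rewrite CRInt_shift by (apply percont_integrable; assumption).
rewrite CRInt_period_shift by assumption; reflexivity.
Qed.

(** The majorant is the real part of a complex-valued [G], so that trigonometric sums typed in [C],
    such as the Fejer kernel, can be used directly. *)
Lemma mean_norm (F G : R -> C) : percont F -> percont G ->
  (forall t, - PI <= t <= PI -> Cmod (F t) <= fst (G t)) -> Cmod (mean F) <= fst (mean G).
Proof.
intros HF HG H. pose proof PI_RGT_0 as P.
assert (Q : 0 < / (2 * PI)) by (apply Rinv_0_lt_compat; lra).
unfold mean. rewrite Cmod_mult, Cmod_R, Rabs_pos_eq by lra.
replace (fst (RtoC (/ (2 * PI)) * CRInt G (- PI) PI)%C)
  with (/ (2 * PI) * RInt (fun t => fst (G t)) (- PI) PI) by (simpl; ring).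
apply Rmult_le_compat_l; [lra|].
apply CRInt_norm; [lra | apply percont_integrable; assumption | | assumption].
apply (percont_integrable G (- PI) PI HG).
Qed.

Lemma mean_bound (F : R -> C) (B : R) : percont F -> (forall t, Cmod (F t) <= B) -> Cmod (mean F) <= B.
Proof.
intros HF H. change B with (fst (RtoC B)). rewrite <- (mean_const (RtoC B)).
apply mean_norm; [assumption | apply percont_const | intros; apply H].
Qed.

(** For [k <> 0] the shift by [pi/k] multiplies the character by -1 and preserves the mean, which
    therefore equals its own opposite. No primitive is computed. *)
Lemma mean_character (k : Z) : mean (character k) = if Z.eq_dec k 0 then 1%C else 0%C.
Proof.
destruct (Z.eq_dec k 0) as [->|Hk].
- rewrite (mean_ext _ (fun _ => 1%C)) by apply character_0. apply mean_const.
- assert (E : character k (PI / IZR k) = RtoC (-1)).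
  { unfold character. replace (IZR k * (PI / IZR k)) with PI by (field; apply not_0_IZR; assumption).
    unfold expi; rewrite cos_PI, sin_PI; reflexivity. }
  pose proof (mean_shift (character k) (PI / IZR k) (percont_character k)) as S.
  rewrite (mean_ext _ (fun t => character k (PI / IZR k) * character k t)%C) in S by (intros; apply character_shift).
  rewrite mean_scal, E in S by apply percont_character.
  pose proof (f_equal fst S) as S1; pose proof (f_equal snd S) as S2; simpl in S1, S2.
  apply C_eq; simpl; lra.
Qed.

(** * Finite sums over lists *)

Fixpoint csum {A : Type} (l : list A) (u : A -> C) : C :=
  match l with nil => 0%C | x :: r => (u x + csum r u)%C end.

Fixpoint rsum {A : Type} (l : list A) (u : A -> R) : R :=
  match l with nil => 0 | x :: r => u x + rsum r u end.

Lemma csum_ext {A} (l : list A) (u v : A -> C) : (forall x, In x l -> u x = v x) -> csum l u = csum l v.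
Proof. induction l as [|a l IH]; intros H; simpl; [reflexivity|]. rewrite IH, H; simpl; auto. intros; apply H; simpl; auto. Qed.

Lemma rsum_le {A} (l : list A) (u v : A -> R) : (forall x, In x l -> u x <= v x) -> rsum l u <= rsum l v.
Proof.
induction l as [|a l IH]; intros H; simpl; [lra|].
apply Rplus_le_compat; [apply H; simpl; auto | apply IH; intros; apply H; simpl; auto].
Qed.

Lemma rsum_ext {A} (l : list A) (u v : A -> R) : (forall x, In x l -> u x = v x) -> rsum l u = rsum l v.
Proof. intros H; apply Rle_antisym; apply rsum_le; intros x Hx; rewrite (H x Hx); lra. Qed.

Lemma rsum_nonneg {A} (l : list A) (u : A -> R) : (forall x, 0 <= u x) -> 0 <= rsum l u.
Proof. intros H; induction l as [|a l IH]; simpl; [lra|]. specialize (H a); lra. Qed.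

Lemma rsum_plus {A} (l : list A) (u v : A -> R) : rsum l (fun x => u x + v x) = rsum l u + rsum l v.
Proof. induction l as [|a l IH]; simpl; [ring|]. rewrite IH; ring. Qed.

Lemma rsum_scal {A} (l : list A) (c : R) (u : A -> R) : rsum l (fun x => c * u x) = c * rsum l u.
Proof. induction l as [|a l IH]; simpl; [ring|]. rewrite IH; ring. Qed.

Lemma rsum_const {A} (l : list A) (c : R) : rsum l (fun _ => c) = INR (length l) * c.
Proof. induction l as [|a l IH]; [simpl; ring|]. simpl rsum; simpl length; rewrite IH, S_INR; ring. Qed.

Lemma rsum_app {A} (l m : list A) (u : A -> R) : rsum (l ++ m) u = rsum l u + rsum m u.
Proof. induction l as [|a l IH]; simpl; [ring|]. rewrite IH; ring. Qed.

Lemma rsum_map {A B} (g : A -> B) (l : list A) (u : B -> R) : rsum (map g l) u = rsum l (fun x => u (g x)).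
Proof. induction l as [|a l IH]; simpl; [ring|]. rewrite IH; ring. Qed.

Lemma csum_scal {A} (l : list A) (c : C) (u : A -> C) : csum l (fun x => c * u x)%C = (c * csum l u)%C.
Proof. induction l as [|a l IH]; simpl; [ring|]. rewrite IH; ring. Qed.

Lemma csum_const {A} (l : list A) (c : C) : csum l (fun _ => c) = (RtoC (INR (length l)) * c)%C.
Proof.
induction l as [|a l IH]; [simpl; ring|]. simpl csum; simpl length; rewrite IH, S_INR, RtoC_plus; ring.
Qed.

Lemma Cmod_csum {A} (l : list A) (u : A -> C) : Cmod (csum l u) <= rsum l (fun x => Cmod (u x)).
Proof.
induction l as [|a l IH]; simpl; [rewrite Cmod_0; lra|].
eapply Rle_trans; [apply Cmod_triangle|]. lra.
Qed.

Lemma rsum_incl {A} (l m : list A) (u : A -> R) : (forall x, 0 <= u x) -> NoDup l -> incl l m -> rsum l u <= rsum m u.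
Proof.
intros Hu; revert m; induction l as [|a l IH]; intros m Hl Hm; simpl.
- apply rsum_nonneg, Hu.
- inversion_clear Hl as [|? ? Hal Hl'].
  destruct (in_split a m (Hm a (or_introl eq_refl))) as [m1 [m2 ->]].
  rewrite rsum_app; simpl.
  assert (rsum l u <= rsum (m1 ++ m2) u).
  { apply IH; [assumption|]. intros x Hx.
    specialize (Hm x (or_intror Hx)). rewrite in_app_iff in *; simpl in Hm.
    destruct Hm as [?|[->|?]]; [tauto | contradiction | tauto]. }
  rewrite rsum_app in *; lra.
Qed.

Lemma percont_csum {A} (l : list A) (G : A -> R -> C) : (forall x, In x l -> percont (G x)) -> percont (fun t => csum l (fun x => G x t)).
Proof.
induction l as [|a l IH]; intros H; simpl; [apply percont_const|].
apply percont_plus; [apply H; simpl; auto | apply IH; intros; apply H; simpl; auto].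
Qed.

Lemma mean_csum {A} (l : list A) (G : A -> R -> C) : (forall x, In x l -> percont (G x)) ->
  mean (fun t => csum l (fun x => G x t)) = csum l (fun x => mean (G x)).
Proof.
induction l as [|a l IH]; intros H; simpl; [apply mean_const|].
rewrite mean_plus, IH; auto.
- intros; apply H; simpl; auto.
- apply H; simpl; auto.
- apply percont_csum; intros; apply H; simpl; auto.
Qed.

Lemma percont_mult_character (F : R -> C) (n : Z) : percont F -> percont (fun t => F t * character n t)%C.
Proof. intros H; apply percont_mult; [exact H | apply percont_character]. Qed.

Lemma fcoef_ext (F G : R -> C) (n : Z) : (forall t, F t = G t) -> fcoef F n = fcoef G n.
Proof. intros H; rewrite 2!fcoef_mean; apply mean_ext; intros t; rewrite H; reflexivity. Qed.

Lemma fcoef_plus (F G : R -> C) (n : Z) : percont F -> percont G -> fcoef (fun t => F t + G t)%C n = (fcoef F n + fcoef G n)%C.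
Proof.
intros; rewrite 3!fcoef_mean, <- mean_plus by (apply percont_mult_character; assumption). apply mean_ext; intros; ring.
Qed.

Lemma fcoef_minus (F G : R -> C) (n : Z) : percont F -> percont G -> fcoef (fun t => F t - G t)%C n = (fcoef F n - fcoef G n)%C.
Proof.
intros; rewrite 3!fcoef_mean, <- mean_minus by (apply percont_mult_character; assumption). apply mean_ext; intros; ring.
Qed.

Lemma fcoef_scal (c : C) (F : R -> C) (n : Z) : percont F -> fcoef (fun t => c * F t)%C n = (c * fcoef F n)%C.
Proof.
intros; rewrite 2!fcoef_mean, <- mean_scal by (apply percont_mult_character; assumption). apply mean_ext; intros; ring.
Qed.

Lemma fcoef_csum {A} (l : list A) (G : A -> R -> C) (n : Z) : (forall x, In x l -> percont (G x)) ->
  fcoef (fun t => csum l (fun x => G x t)) n = csum l (fun x => fcoef (G x) n).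
Proof.
induction l as [|a l IH]; intros H; simpl.
- rewrite fcoef_mean, (mean_ext _ (fun _ => 0%C)); [apply mean_const | intros; ring].
- rewrite fcoef_plus, IH; auto.
  + intros; apply H; simpl; auto.
  + apply H; simpl; auto.
  + apply percont_csum; intros; apply H; simpl; auto.
Qed.

Lemma fcoef_bound (F : R -> C) (B : R) (n : Z) : percont F -> (forall t, Cmod (F t) <= B) -> Cmod (fcoef F n) <= B.
Proof.
intros HF H; rewrite fcoef_mean; apply mean_bound; [apply percont_mult_character; assumption|].
intros t; rewrite Cmod_mult, Cmod_character, Rmult_1_r; apply H.
Qed.

Lemma fcoef_mod (F : R -> C) (k n : Z) : fcoef (fun t => character k t * F t)%C n = fcoef F (n - k).
Proof.
rewrite 2!fcoef_mean; apply mean_ext; intros t.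
replace (- (n - k))%Z with (- n + k)%Z by ring. rewrite <- character_mult; ring.
Qed.

Lemma fcoef_shift (F : R -> C) (s : R) (n : Z) : percont F -> fcoef (fun t => F (t + s)) n = (character n s * fcoef F n)%C.
Proof.
intros HF; rewrite 2!fcoef_mean.
rewrite <- (mean_shift (fun t => F t * character (- n) t)%C s) by (apply percont_mult_character; assumption).
rewrite <- mean_scal by (apply (percont_shift (fun t => F t * character (- n) t)%C); apply percont_mult_character; assumption).
apply mean_ext; intros t.
rewrite character_shift, Cmult_assoc, (Cmult_comm (character n s)), <- Cmult_assoc.
rewrite (Cmult_assoc (character n s)), character_mult. replace (n + - n)%Z with 0%Z by ring. rewrite character_0; ring.
Qed.

Lemma fcoef_character (k n : Z) : fcoef (character k) n = if Z.eq_dec n k then 1%C else 0%C.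
Proof.
rewrite fcoef_mean, (mean_ext _ (character (k - n))) by (intros; rewrite character_mult; f_equal; ring).
rewrite mean_character. destruct (Z.eq_dec (k - n) 0), (Z.eq_dec n k); try reflexivity; lia.
Qed.

(** * The Wiener norm *)

(** The [l^1] norm of the coefficients is encoded by its upper bounds: finite sets of frequencies
    are duplicate-free lists. This keeps infinite series out of everything except the final
    translation to [w_abs_conv]. *)
Definition wnorm_le (F : R -> C) (M : R) : Prop :=
  percont F /\ forall l, NoDup l -> rsum l (fun n => Cmod (fcoef F n)) <= M.

Lemma NoDup_map_inj {A B} (g : A -> B) (l : list A) : (forall x y, g x = g y -> x = y) -> NoDup l -> NoDup (map g l).
Proof. apply Injective_map_NoDup. Qed.

(** * The Fejer kernel: the Wiener norm dominates the sup norm *)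

Definition zseq (n : nat) : list Z := map Z.of_nat (seq 0 n).

Lemma NoDup_zseq (n : nat) : NoDup (zseq n).
Proof. apply NoDup_map_inj; [intros; lia | apply seq_NoDup]. Qed.

Lemma length_zseq (n : nat) : length (zseq n) = n.
Proof. unfold zseq; rewrite length_map, length_seq; reflexivity. Qed.

Lemma csum_app {A} (l m : list A) (u : A -> C) : csum (l ++ m) u = (csum l u + csum m u)%C.
Proof. induction l as [|a l IH]; simpl; [ring|]. rewrite IH; ring. Qed.

Lemma zseq_S (n : nat) : zseq (S n) = zseq n ++ Z.of_nat n :: nil.
Proof. unfold zseq; rewrite seq_S, map_app; reflexivity. Qed.

Lemma dirichlet_telescope (n : nat) (t : R) :
  ((1 - character 1 t) * csum (zseq n) (fun j => character j t))%C = (1 - character (Z.of_nat n) t)%C.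
Proof.
induction n as [|n IH].
- simpl; rewrite character_0; ring.
- rewrite zseq_S, csum_app, Cmult_plus_distr_l, IH. simpl csum.
  replace (Z.of_nat (S n)) with (1 + Z.of_nat n)%Z by lia. rewrite <- character_mult; ring.
Qed.

Lemma Cconj_character (k : Z) (t : R) : Cconj (character k t) = character (- k) t.
Proof.
unfold character, expi, Cconj; simpl. rewrite opp_IZR, <- Ropp_mult_distr_l, cos_neg, sin_neg; reflexivity.
Qed.

Lemma Cconj_csum {A} (l : list A) (u : A -> C) : Cconj (csum l u) = csum l (fun x => Cconj (u x)).
Proof.
induction l as [|a l IH]; simpl; [apply C_eq; simpl; ring|]. rewrite Cplus_conj, IH; reflexivity.
Qed.

(* The (unnormalised) Fejer kernel [|D_n|^2], with [D_n] the one-sided Dirichlet sum. *)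
Definition fejer (n : nat) (t : R) : C := csum (zseq n) (fun i => csum (zseq n) (fun j => character (i - j) t)).

Lemma percont_fejer (n : nat) : percont (fejer n).
Proof. apply percont_csum; intros i _. apply (percont_csum (zseq n) (fun j => character (i - j))); intros; apply percont_character. Qed.

Lemma fejer_square (n : nat) (t : R) : fejer n t = RtoC (Cmod (csum (zseq n) (fun j => character j t)) ^ 2).
Proof.
rewrite Cmod2_conj, Cconj_csum, Cmult_comm, <- csum_scal.
apply csum_ext; intros i _. rewrite Cmult_comm, <- csum_scal.
apply csum_ext; intros j _. rewrite Cconj_character, character_mult; f_equal; ring.
Qed.

(** Only the [n] diagonal terms [i = j] have non-zero mean. *)
Lemma mean_fejer (n : nat) : mean (fejer n) = RtoC (INR n).
Proof.
unfold fejer. rewrite mean_csum by (intros i _; apply (percont_csum (zseq n) (fun j => character (i - j))); intros; apply percont_character).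
rewrite (csum_ext _ _ (fun _ => 1%C)); [rewrite csum_const, length_zseq; ring|].
intros i Hi. rewrite (mean_csum (zseq n) (fun j => character (i - j))) by (intros; apply percont_character).
generalize (NoDup_zseq n). revert Hi. generalize (zseq n).
intros l; induction l as [|a l IH]; intros Hi Hl; [destruct Hi|]. inversion_clear Hl as [|? ? Ha Hl'].
simpl; rewrite mean_character. destruct (Z.eq_dec (i - a) 0) as [E|E].
- assert (i = a) by lia; subst a.
  rewrite (csum_ext _ _ (fun _ => 0%C)); [rewrite csum_const; ring|].
  intros j Hj; rewrite mean_character. destruct (Z.eq_dec (i - j) 0); [|reflexivity].
  assert (i = j) by lia; subst; contradiction.
- destruct Hi as [->|Hi]; [lia|]. rewrite IH by assumption; ring.
Qed.

(** For fixed [i] the inner sum over [j] meets the coefficients of [F] at the distinct frequencies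
    [j - i], so it is at most [M]; there are [n] values of [i]. *)
Lemma mean_mult_fejer (F : R -> C) (M : R) (n : nat) : wnorm_le F M ->
  Cmod (mean (fun t => F t * fejer n t)%C) <= INR n * M.
Proof.
intros [HF H].
rewrite (mean_ext _ (fun t => csum (zseq n) (fun i => csum (zseq n) (fun j => F t * character (i - j) t)%C))).
2: { intros t; unfold fejer; rewrite <- csum_scal; apply csum_ext; intros; rewrite <- csum_scal; reflexivity. }
assert (P : forall i, percont (fun t => csum (zseq n) (fun j => F t * character (i - j) t)%C)).
{ intros i; apply (percont_csum (zseq n) (fun j t => F t * character (i - j) t)%C); intros; apply percont_mult_character, HF. }
rewrite mean_csum by (intros; apply P).
eapply Rle_trans; [apply Cmod_csum|].
eapply Rle_trans; [|right; rewrite <- (length_zseq n) at 1; apply rsum_const].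
apply rsum_le; intros i _.
rewrite (mean_csum (zseq n) (fun j t => F t * character (i - j) t)%C) by (intros; apply percont_mult_character, HF).
eapply Rle_trans; [apply Cmod_csum|].
eapply Rle_trans; [|apply (H (map (fun j => (j - i)%Z) (zseq n)))].
- rewrite rsum_map; right; apply rsum_ext; intros j _. rewrite fcoef_mean. do 3 f_equal.
  apply functional_extensionality; intros t; do 2 f_equal; ring.
- apply NoDup_map_inj; [intros; lia | apply NoDup_zseq].
Qed.

Lemma Cmod_one_sub_character (t : R) : Cmod (1 - character 1 t) ^ 2 = 2 - 2 * cos t.
Proof.
rewrite Cmod2_alt; unfold character, expi, Re, Im; simpl. rewrite Rmult_1_l.
pose proof (sin2_cos2 t) as S; unfold Rsqr in S. nra.
Qed.

(** The left side is the square of the modulus of the telescoped product [1 - character n t], which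
    is at most 2. The bound does not depend on [n], while the mean of the kernel is [n]: this is its
    concentration at 0. *)
Lemma fejer_decay (n : nat) (t : R) : (2 - 2 * cos t) * fst (fejer n t) <= 4.
Proof.
rewrite fejer_square, <- Cmod_one_sub_character; unfold RtoC; cbn [fst].
replace 4 with (2 ^ 2) by ring. rewrite <- Rpow_mult_distr, <- Cmod_mult, dirichlet_telescope.
apply pow_incr; split; [apply Cmod_ge_0|].
unfold Cminus; eapply Rle_trans; [apply Cmod_triangle|]. rewrite Cmod_opp, Cmod_1, Cmod_character; lra.
Qed.

(** Replaces the splitting of an integral into a near and a far part by one pointwise majorant. Near
    0 continuity gives [eps]; further away boundedness is paid by the squared chord [2 - 2 cos t],
    whose product with the kernel is controlled by [fejer_decay]. *)
Lemma cont_chord (F : R -> C) (eps : R) : percont F -> 0 < eps ->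
  exists K, 0 <= K /\ forall t, - PI <= t <= PI -> Cmod (F 0 - F t) <= eps + K * (2 - 2 * cos t).
Proof.
intros HF He. destruct (percont_bounded F HF) as [B HB].
destruct (proj1 (ccont_eps F 0) (proj1 HF 0) eps He) as [d [Hd H]].
(* The cap at 1 keeps [d'] inside the interval from 0 to [pi], where [cos] decreases. *)
set (d' := Rmin d 1). pose proof PI2_1 as HP1.
assert (Hd' : 0 < d' <= 1) by (split; [apply Rmin_pos; lra | apply Rmin_r]).
assert (B0 : 0 <= B) by (eapply Rle_trans; [apply Cmod_ge_0 | apply (HB 0)]).
assert (Hc : cos d' < 1) by (rewrite <- cos_0; apply cos_decreasing_1; lra).
exists (2 * B / (2 - 2 * cos d')); split; [apply Rdiv_le_0_compat; lra|].
intros t Ht. destruct (Rlt_dec (Rabs t) d') as [L|L].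
- assert (L' : Rabs (t - 0) < d) by (rewrite Rminus_0_r; pose proof (Rmin_l d 1 : d' <= d); lra).
  specialize (H t L'). rewrite <- Cmod_opp. replace (- (F 0 - F t))%C with (F t - F 0)%C by ring.
  assert (0 <= 2 * B / (2 - 2 * cos d')) by (apply Rdiv_le_0_compat; lra).
  pose proof (COS_bound t). nra.
- assert (E : cos t = cos (Rabs t)) by (unfold Rabs; destruct (Rcase_abs t); [rewrite cos_neg|]; reflexivity).
  assert (A : Rabs t <= PI) by (apply Rabs_le; lra).
  assert (Q : cos (Rabs t) <= cos d') by (apply cos_decr_1; lra).
  assert (2 * B <= 2 * B / (2 - 2 * cos d') * (2 - 2 * cos t)).
  { rewrite E. apply Rle_trans with (2 * B / (2 - 2 * cos d') * (2 - 2 * cos d')).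
    - right; field; lra.
    - apply Rmult_le_compat_l; [apply Rdiv_le_0_compat; lra | lra]. }
  unfold Cminus; pose proof (Cmod_triangle (F 0) (- F t)) as T; rewrite Cmod_opp in T.
  pose proof (HB 0); pose proof (HB t); lra.
Qed.

(** Write [n F(0)] as the mean of [F * fejer n] plus the mean of [(F 0 - F) * fejer n]. The first is
    at most [n M], the second at most [n eps/2 + 4 K] by [cont_chord] and [fejer_decay]; divide by a
    large [n]. *)
Lemma wnorm_le_at_0 (F : R -> C) (M : R) : wnorm_le F M -> Cmod (F 0) <= M.
Proof.
intros HA; pose proof HA as [HF H].
apply le_epsilon; intros eps He.
destruct (cont_chord F (eps / 2) HF ltac:(lra)) as [K [HK0 HK]].
destruct (INR_unbounded (8 * K / eps)) as [n Hn].
assert (Hn0 : 0 < INR n).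
{ eapply Rle_lt_trans; [|exact Hn]. apply Rdiv_le_0_compat; lra. }
assert (Hn1 : 4 * K <= eps / 2 * INR n).
{ apply Rmult_lt_compat_r with (r := eps / 2) in Hn; [|lra].
  replace (8 * K / eps * (eps / 2)) with (4 * K) in Hn by (field; lra). lra. }
assert (P1 : percont (fun t => F 0 * fejer n t)%C) by (apply percont_scal, percont_fejer).
assert (P2 : percont (fun t => F t * fejer n t)%C) by (apply percont_mult; [assumption | apply percont_fejer]).
assert (E : (F 0 * RtoC (INR n))%C =
   (mean (fun t => F t * fejer n t) + mean (fun t => F 0 * fejer n t - F t * fejer n t))%C).
{ rewrite mean_minus, mean_scal, mean_fejer by (assumption || apply percont_fejer). ring. }
assert (B2 : Cmod (mean (fun t => F 0 * fejer n t - F t * fejer n t))%C <= eps / 2 * INR n + 4 * K).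
{ replace (eps / 2 * INR n + 4 * K) with
    (fst (mean (fun t => RtoC (eps / 2) * fejer n t + RtoC (4 * K))%C)).
  - apply mean_norm.
    + apply percont_minus; assumption.
    + apply percont_plus; [apply percont_scal, percont_fejer | apply percont_const].
    + intros t Ht.
      replace (F 0 * fejer n t - F t * fejer n t)%C with ((F 0 - F t) * fejer n t)%C by ring.
      rewrite Cmod_mult.
      pose proof (HK t Ht) as H1. pose proof (fejer_decay n t) as H2.
      assert (H3 : Cmod (fejer n t) = fst (fejer n t) /\ 0 <= fst (fejer n t) /\ snd (fejer n t) = 0).
      { rewrite fejer_square. rewrite Cmod_R; unfold RtoC; cbn [fst snd].
        split; [apply Rabs_pos_eq | split; [|reflexivity]]; apply pow2_ge_0. }
      destruct H3 as [-> [H3 H4]]. simpl. rewrite H4. nra.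
  - rewrite mean_plus, mean_scal, mean_fejer, mean_const by (apply percont_const || apply percont_fejer || apply percont_scal, percont_fejer).
    simpl; ring. }
pose proof (mean_mult_fejer F M n HA) as B1.
assert (T : Cmod (F 0) * INR n <= INR n * M + (eps / 2 * INR n + 4 * K)).
{ rewrite <- (Rabs_pos_eq (INR n)) at 1 by lra. rewrite <- Cmod_R, <- Cmod_mult, E.
  eapply Rle_trans; [apply Cmod_triangle|]. lra. }
apply Rmult_le_reg_r with (INR n); [assumption|]. nra.
Qed.

Lemma wnorm_le_shift (F : R -> C) (M s : R) : wnorm_le F M -> wnorm_le (fun t => F (t + s)) M.
Proof.
intros [HF H]; split; [apply percont_shift; assumption|].
intros l Hl; eapply Rle_trans; [|apply (H l Hl)].
right; apply rsum_ext; intros n _. rewrite fcoef_shift, Cmod_mult, Cmod_character by assumption; ring.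
Qed.

Lemma wnorm_le_sup (F : R -> C) (M : R) : wnorm_le F M -> forall t, Cmod (F t) <= M.
Proof.
intros H t. pose proof (wnorm_le_at_0 _ _ (wnorm_le_shift F M t H)) as K; cbv beta in K; rewrite Rplus_0_l in K; exact K.
Qed.

(** A fixed finite sum of coefficients is continuous for the sup norm, so uniform approximation
    suffices; its quality may depend on the length of [l]. *)
Lemma wnorm_le_limit (F : R -> C) (M : R) : percont F ->
  (forall eps, 0 < eps -> exists G, wnorm_le G M /\ forall t, Cmod (F t - G t) <= eps) -> wnorm_le F M.
Proof.
intros HF H; split; [exact HF|]. intros l Hl. apply le_epsilon; intros eps He.
assert (HL : 0 < INR (length l) + 1) by (pose proof (pos_INR (length l)); lra).
destruct (H (eps / (INR (length l) + 1))) as [G [[HG HGM] HFG]]; [apply Rdiv_lt_0_compat; lra|].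
apply Rle_trans with (rsum l (fun n => Cmod (fcoef G n) + eps / (INR (length l) + 1))).
- apply rsum_le; intros n _.
  pose proof (fcoef_bound _ _ n (percont_minus F G HF HG) HFG) as K. rewrite fcoef_minus in K by assumption.
  replace (fcoef F n) with (fcoef G n + (fcoef F n - fcoef G n))%C by ring.
  eapply Rle_trans; [apply Cmod_triangle|]. lra.
- rewrite rsum_plus, rsum_const. specialize (HGM l Hl).
  assert (INR (length l) * (eps / (INR (length l) + 1)) <= eps); [|lra].
  apply Rmult_le_reg_r with (INR (length l) + 1); [assumption|].
  field_simplify; lra.
Qed.

Lemma wnorm_le_weaken (F : R -> C) (M N : R) : M <= N -> wnorm_le F M -> wnorm_le F N.
Proof. intros HMN [HF H]; split; [exact HF|]. intros l Hl; specialize (H l Hl); lra. Qed.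

Lemma wnorm_le_nonneg (F : R -> C) (M : R) : wnorm_le F M -> 0 <= M.
Proof. intros [_ H]. exact (H nil (NoDup_nil Z)). Qed.

Lemma wnorm_le_ext (F G : R -> C) (M : R) : (forall t, F t = G t) -> wnorm_le F M -> wnorm_le G M.
Proof. intros H; replace G with F; [auto | apply functional_extensionality; assumption]. Qed.

Lemma wnorm_le_plus (F G : R -> C) (M N : R) : wnorm_le F M -> wnorm_le G N -> wnorm_le (fun t => F t + G t)%C (M + N).
Proof.
intros [HF HM] [HG HN]; split; [apply percont_plus; assumption|]. intros l Hl.
apply Rle_trans with (rsum l (fun n => Cmod (fcoef F n) + Cmod (fcoef G n))).
- apply rsum_le; intros n _. rewrite fcoef_plus by assumption. apply Cmod_triangle.
- rewrite rsum_plus. apply Rplus_le_compat; auto.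
Qed.

Lemma wnorm_le_scal (c : C) (F : R -> C) (M : R) : wnorm_le F M -> wnorm_le (fun t => c * F t)%C (Cmod c * M).
Proof.
intros [HF HM]; split; [apply percont_scal; assumption|]. intros l Hl.
rewrite (rsum_ext _ _ (fun n => Cmod c * Cmod (fcoef F n))).
- rewrite rsum_scal. apply Rmult_le_compat_l; [apply Cmod_ge_0 | auto].
- intros n _. rewrite fcoef_scal, Cmod_mult by assumption; reflexivity.
Qed.

Lemma wnorm_le_character_mult (k : Z) (F : R -> C) (M : R) : wnorm_le F M -> wnorm_le (fun t => character k t * F t)%C M.
Proof.
intros [HF HM]; split; [apply percont_mult; [apply percont_character | assumption]|]. intros l Hl.
eapply Rle_trans; [|apply (HM (map (fun n => (n - k)%Z) l))].
- rewrite rsum_map; right; apply rsum_ext; intros n _. rewrite fcoef_mod; reflexivity.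
- apply NoDup_map_inj; [intros; lia | assumption].
Qed.

Lemma wnorm_le_zero : wnorm_le (fun _ => 0%C) 0.
Proof.
split; [apply percont_const|]. intros l _. rewrite (rsum_ext _ _ (fun _ => 0)); [rewrite rsum_const; lra|].
intros n _. rewrite fcoef_mean, (mean_ext _ (fun _ => 0%C)) by (intros; ring). rewrite mean_const; apply Cmod_0.
Qed.

Lemma wnorm_le_csum {A} (l : list A) (G : A -> R -> C) (M : A -> R) : (forall x, In x l -> wnorm_le (G x) (M x)) ->
  wnorm_le (fun t => csum l (fun x => G x t)) (rsum l M).
Proof.
induction l as [|a l IH]; intros H; simpl; [apply wnorm_le_zero|].
apply wnorm_le_plus; [apply H; simpl; auto | apply IH; intros; apply H; simpl; auto].
Qed.

Lemma wnorm_le_one : wnorm_le (fun _ => 1%C) 1.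
Proof.
split; [apply percont_const|]. intros l Hl.
assert (E : forall n, Cmod (fcoef (fun _ => 1%C) n) = if Z.eq_dec n 0 then 1 else 0).
{ intros n. rewrite (fcoef_ext _ (character 0)) by (intros; rewrite character_0; reflexivity).
  rewrite fcoef_character. destruct (Z.eq_dec n 0); [apply Cmod_1 | apply Cmod_0]. }
rewrite (rsum_ext _ _ _ (fun n _ => E n)).
induction Hl as [|a l Ha Hl IH]; simpl; [lra|].
destruct (Z.eq_dec a 0) as [->|]; [|lra].
rewrite (rsum_ext _ _ (fun _ => 0)); [rewrite rsum_const; lra|].
intros x Hx; destruct (Z.eq_dec x 0) as [->|]; [contradiction | reflexivity].
Qed.

Definition psum (F : R -> C) (l : list Z) (t : R) : C := csum l (fun k => fcoef F k * character k t)%C.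

Lemma percont_psum (F : R -> C) (l : list Z) : percont (psum F l).
Proof. apply (percont_csum l (fun k t => fcoef F k * character k t)%C); intros; apply percont_scal, percont_character. Qed.

Lemma fcoef_psum (F : R -> C) (l : list Z) (n : Z) : NoDup l ->
  fcoef (psum F l) n = if in_dec Z.eq_dec n l then fcoef F n else 0%C.
Proof.
intros Hl. unfold psum. rewrite (fcoef_csum l (fun k t => fcoef F k * character k t)%C) by (intros; apply percont_scal, percont_character).
rewrite (csum_ext _ _ (fun k => if Z.eq_dec n k then fcoef F n else 0%C)).
2: { intros k _. rewrite fcoef_scal, fcoef_character by apply percont_character. destruct (Z.eq_dec n k) as [->|]; ring. }
induction Hl as [|a l Ha Hl IH]; [reflexivity|].
simpl csum. rewrite IH.
destruct (in_dec Z.eq_dec n l) as [I|I], (in_dec Z.eq_dec n (a :: l)) as [rect_int|rect_int], (Z.eq_dec n a) as [K|K];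
  simpl in rect_int; try ring; subst; try tauto.
destruct rect_int as [rect_int|rect_int]; [symmetry in rect_int|]; contradiction.
Qed.

(** Choose [l] whose sum is within [eps] of the supremum of all finite sums; any set of frequencies
    outside [l] then carries at most [eps]. *)
Lemma wnorm_le_approx (F : R -> C) (M eps : R) : wnorm_le F M -> 0 < eps ->
  exists l, NoDup l /\ wnorm_le (fun t => F t - psum F l t)%C eps.
Proof.
intros [HF HM] He.
set (E := fun x => exists l, NoDup l /\ x = rsum l (fun n => Cmod (fcoef F n))).
destruct (completeness E) as [S [HS1 HS2]].
- exists M; intros x [l [Hl ->]]; auto.
- exists 0, nil; split; [constructor | reflexivity].
- destruct (classic (exists l, NoDup l /\ S - eps < rsum l (fun n => Cmod (fcoef F n)))) as [[l [Hl HlS]]|N].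
  2: { exfalso. assert (S <= S - eps); [|lra]. apply HS2. intros x [l [Hl ->]].
       apply Rnot_lt_le; intros K; apply N; exists l; auto. }
  exists l; split; [assumption|]. split; [apply percont_minus; [assumption | apply percont_psum]|].
  intros m Hm.
  assert (Q : rsum m (fun n => Cmod (fcoef (fun t => F t - psum F l t)%C n)) =
    rsum (filter (fun n => if in_dec Z.eq_dec n l then false else true) m) (fun n => Cmod (fcoef F n))).
  { clear Hm; induction m as [|a m IH]; simpl; [reflexivity|].
    rewrite IH, fcoef_minus, fcoef_psum by (assumption || apply percont_psum).
    destruct (in_dec Z.eq_dec a l); simpl.
    - replace (fcoef F a - fcoef F a)%C with (RtoC 0) by ring. rewrite Cmod_0; ring.
    - do 2 f_equal. ring. }
  rewrite Q.
  (* [l] together with the part of [m] outside [l] is again duplicate-free, so its sum stays below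
     the supremum. *)
  assert (HE : E (rsum (l ++ filter (fun n => if in_dec Z.eq_dec n l then false else true) m) (fun n => Cmod (fcoef F n)))).
  { eexists; split; [|reflexivity]. apply NoDup_app; [assumption | apply NoDup_filter; assumption|].
    intros x Hx Hx'. apply filter_In in Hx' as [_ Hx']. destruct (in_dec Z.eq_dec x l); [discriminate | contradiction]. }
  apply HS1 in HE. rewrite rsum_app in HE. lra.
Qed.

(** Avoids the convolution formula. With [F] replaced by a partial sum, the product is a finite
    combination of modulations of [G], each of the same Wiener norm as [G]; [wnorm_le_limit] removes
    the truncation, the error being uniform by [wnorm_le_sup]. *)
Lemma wnorm_le_mult (F G : R -> C) (M N : R) : wnorm_le F M -> wnorm_le G N -> wnorm_le (fun t => F t * G t)%C (M * N).
Proof.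
intros HF HG. apply wnorm_le_limit; [apply percont_mult; [apply HF | apply HG]|].
intros eps He. pose proof (wnorm_le_nonneg _ _ HG) as HN.
destruct (wnorm_le_approx F M (eps / (N + 1)) HF) as [l [Hl Hl']]; [apply Rdiv_lt_0_compat; lra|].
exists (fun t => psum F l t * G t)%C. split.
- apply (wnorm_le_weaken _ (rsum l (fun k => Cmod (fcoef F k) * N))).
  { rewrite (rsum_ext _ _ (fun k => N * Cmod (fcoef F k))) by (intros; ring).
    rewrite rsum_scal, Rmult_comm. apply Rmult_le_compat_r; [assumption | apply HF; assumption]. }
  apply (wnorm_le_ext (fun t => csum l (fun k => fcoef F k * (character k t * G t))%C)).
  + intros t; unfold psum. rewrite Cmult_comm, <- csum_scal. apply csum_ext; intros; ring.
  + apply (wnorm_le_csum l (fun k t => fcoef F k * (character k t * G t))%C (fun k => Cmod (fcoef F k) * N)).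
    intros; apply wnorm_le_scal, wnorm_le_character_mult; assumption.
- intros t. replace (F t * G t - psum F l t * G t)%C with ((F t - psum F l t) * G t)%C by ring.
  rewrite Cmod_mult. pose proof (wnorm_le_sup _ _ Hl' t) as H1; pose proof (wnorm_le_sup _ _ HG t) as H2.
  cbv beta in H1. apply Rle_trans with (eps / (N + 1) * N).
  + apply Rmult_le_compat; auto using Cmod_ge_0.
  + apply Rmult_le_reg_r with (N + 1); [lra|]. field_simplify; nra.
Qed.

Lemma wnorm_le_pow (F : R -> C) (M : R) (k : nat) : wnorm_le F M -> wnorm_le (fun t => F t ^ k)%C (M ^ k).
Proof.
intros H; induction k as [|k IH]; simpl; [apply wnorm_le_one|].
apply wnorm_le_mult; assumption.
Qed.

(** * Wiener bounds from second differences *)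

Lemma NoDup_rsum_Z (u : Z -> R) (T : R) (l : list Z) : (forall n, 0 <= u n) ->
  (forall N, rsum (zseq N) u + rsum (zseq N) (fun n => u (- n)%Z) <= T) -> NoDup l -> rsum l u <= T.
Proof.
intros Hu H Hl.
assert (B : exists N, forall x, In x l -> (Z.abs x < Z.of_nat N)%Z).
{ clear Hl; induction l as [|a l [N IH]]; [exists 0%nat; intros x []|].
  exists (Nat.max N (S (Z.abs_nat a))). intros x [<-|Hx]; [lia | specialize (IH x Hx); lia]. }
destruct B as [N HN]. specialize (H N).
rewrite <- (rsum_map Z.opp (zseq N) u), <- rsum_app in H.
(* Index 0 is counted in both halves, as in [summable_Z]; only inclusion is needed because [u] is
   non-negative. *)
eapply Rle_trans; [|exact H]. apply rsum_incl; try assumption.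
intros x Hx; specialize (HN x Hx). apply in_or_app. unfold zseq.
destruct (Z_le_gt_dec 0 x); [left | right].
- apply in_map_iff; exists (Z.to_nat x); split; [lia | apply in_seq; lia].
- apply in_map_iff; exists (- x)%Z; split; [lia|].
  apply in_map_iff; exists (Z.to_nat (- x)); split; [lia | apply in_seq; lia].
Qed.

Lemma zseq_inv_sq (u : Z -> R) (K : R) (N : nat) : 0 <= K -> u 0%Z = 0 ->
  (forall n, (0 < n)%nat -> u (Z.of_nat n) <= K / (INR n) ^ 2) -> rsum (zseq N) u <= 2 * K.
Proof.
intros HK H0 H. pose proof (pos_INR N) as P.
destruct N as [|N]; [simpl; lra|].
(* Strengthened for the induction by the telescoping majorant [1/n^2 <= 2/n - 2/(n+1)] for
   [n >= 1]. *)
assert (Q : rsum (zseq (S N)) u <= 2 * K - 2 * K / (INR N + 1)).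
{ clear P; induction N as [|N IH].
  - simpl. rewrite H0. right; field.
  - rewrite zseq_S, rsum_app. cbn [rsum]. pose proof (H (S N) (Nat.lt_0_succ N)) as H1.
    rewrite S_INR in *. pose proof (pos_INR N) as P.
    assert (K / (INR N + 1) ^ 2 <= 2 * K / (INR N + 1) - 2 * K / (INR N + 1 + 1)); [|lra].
    replace (2 * K / (INR N + 1) - 2 * K / (INR N + 1 + 1))
      with (K / (INR N + 1) ^ 2 + K * INR N / ((INR N + 1) ^ 2 * (INR N + 2))) by (field; lra).
    assert (0 <= K * INR N / ((INR N + 1) ^ 2 * (INR N + 2))); [|lra].
    apply Rdiv_le_0_compat; [nra|]. apply Rmult_lt_0_compat; [apply pow_lt; lra | lra]. }
rewrite S_INR in P. assert (0 <= 2 * K / (INR N + 1)); [|lra].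
pose proof (pos_INR N); apply Rdiv_le_0_compat; lra.
Qed.

(** For [s = pi/n] both shifts multiply the [n]-th coefficient by -1, so the second difference has
    [n]-th coefficient -4 times that of [F]. Hence the latter is at most [K pi^2 / (4 n^2)]. Each
    half of the integers contributes [2 * (K pi^2 / 4)], and [B] pays for [n = 0]. *)
Lemma wnorm_le_second_difference (F : R -> C) (B K : R) : percont F -> 0 <= K -> (forall t, Cmod (F t) <= B) ->
  (forall t s, Cmod (F (t + s) + F (t - s) - 2 * F t) <= K * s ^ 2) -> wnorm_le F (B + K * PI ^ 2).
Proof.
intros HF HK HB H; split; [exact HF|]. intros l Hl.
assert (D : forall n : Z, n <> 0%Z -> Cmod (fcoef F n) <= K * PI ^ 2 / 4 / (IZR n) ^ 2).
{ intros n Hn. assert (Hn' : IZR n <> 0) by (apply not_0_IZR; assumption).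
  set (s := PI / IZR n).
  assert (E : character n s = RtoC (-1) /\ character n (- s) = RtoC (-1)).
  { unfold character, s. replace (IZR n * (PI / IZR n)) with PI by (field; assumption).
    replace (IZR n * - (PI / IZR n)) with (- PI) by (field; assumption).
    unfold expi; rewrite cos_neg, sin_neg, cos_PI, sin_PI, Ropp_0; split; reflexivity. }
  destruct E as [E1 E2].
  assert (P1 : percont (fun t => F (t + s))) by (apply percont_shift; assumption).
  assert (P2 : percont (fun t => F (t + - s))) by (apply percont_shift; assumption).
  pose proof (fcoef_bound (fun t => F (t + s)%R + F (t + - s)%R - 2 * F t)%C (K * s ^ 2) n
    (percont_minus _ _ (percont_plus _ _ P1 P2) (percont_scal 2 F HF)) (fun t => H t s)) as Q.
  rewrite (fcoef_minus (fun t => F (t + s)%R + F (t + - s)%R)%C (fun t => 2 * F t)%C) in Q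
    by (apply percont_plus || apply percont_scal; assumption).
  rewrite (fcoef_plus (fun t => F (t + s)) (fun t => F (t + - s))), fcoef_scal, !fcoef_shift, E1, E2 in Q by assumption.
  replace (RtoC (-1) * fcoef F n + RtoC (-1) * fcoef F n - 2 * fcoef F n)%C with (RtoC (-4) * fcoef F n)%C in Q
    by (apply C_eq; simpl; ring).
  rewrite Cmod_mult, Cmod_R, Rabs_left in Q by lra.
  replace (K * PI ^ 2 / 4 / IZR n ^ 2) with (K * s ^ 2 / 4) by (unfold s; field; assumption). lra. }
set (u := fun n => if Z.eq_dec n 0 then 0 else Cmod (fcoef F n)).
set (v := fun n => if Z.eq_dec n 0 then Cmod (fcoef F 0) else 0).
rewrite (rsum_ext _ _ (fun n => v n + u n)).
2: { intros n _; unfold u, v; destruct (Z.eq_dec n 0) as [->|]; ring. }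
rewrite rsum_plus. apply Rplus_le_compat.
- assert (V : rsum l v <= Cmod (fcoef F 0)).
  { unfold v; clear u v D; induction Hl as [|a l Ha Hl IH]; simpl; [apply Cmod_ge_0|].
    destruct (Z.eq_dec a 0) as [->|]; [|lra].
    rewrite (rsum_ext _ _ (fun _ => 0)); [rewrite rsum_const; lra|].
    intros x Hx; destruct (Z.eq_dec x 0) as [->|]; [contradiction | reflexivity]. }
  pose proof (fcoef_bound F B 0 HF HB); lra.
- pose proof (pow2_ge_0 PI) as P.
  apply (NoDup_rsum_Z u); [| |exact Hl].
  + intros n; unfold u; destruct (Z.eq_dec n 0); [lra | apply Cmod_ge_0].
  + intros N. replace (K * PI ^ 2) with (2 * (K * PI ^ 2 / 4) + 2 * (K * PI ^ 2 / 4)) by field.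
    apply Rplus_le_compat; apply zseq_inv_sq; try (unfold u; simpl; reflexivity); try nra.
    * intros n Hn; unfold u; destruct (Z.eq_dec (Z.of_nat n) 0); [lia|].
      rewrite INR_IZR_INZ; apply D; assumption.
    * intros n Hn; unfold u; destruct (Z.eq_dec (- Z.of_nat n) 0); [lia|].
      rewrite INR_IZR_INZ. replace (IZR (Z.of_nat n) ^ 2) with (IZR (- Z.of_nat n) ^ 2) by (rewrite opp_IZR; ring).
      apply D; assumption.
Qed.

(** * Goursat's theorem *)

(** Complex differentiability at [x + i y] in the real coordinates suited to rectangles: the pair
    [(x' - x, y' - y)] is the complex increment, and its size is measured by the sum norm. *)
Definition hdiff (h : R -> R -> C) (x y : R) : Prop :=
  exists b : C, forall eps, 0 < eps -> exists del, 0 < del /\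
    forall x' y', Rabs (x' - x) < del -> Rabs (y' - y) < del ->
      Cmod (h x' y' - h x y - b * (x' - x, y' - y)%R)%C <= eps * (Rabs (x' - x) + Rabs (y' - y)).

Lemma hdiff_ccont (h : R -> R -> C) (x y : R) : hdiff h x y ->
  ccont (fun x' => h x' y) x /\ ccont (fun y' => h x y') y.
Proof.
intros [b H]. destruct (H 1 Rlt_0_1) as [d [Hd K]].
assert (Kb : 0 <= Cmod b) by apply Cmod_ge_0.
assert (Q : forall x' y' eps, 0 < eps -> Rabs (x' - x) + Rabs (y' - y) < eps / (1 + Cmod b) ->
   Rabs (x' - x) < d -> Rabs (y' - y) < d -> Cmod (h x' y' - h x y) < eps).
{ intros x' y' eps He Hs H1 H2. specialize (K x' y' H1 H2).
  replace (h x' y' - h x y)%C with ((h x' y' - h x y - b * (x' - x, y' - y)%R) + b * (x' - x, y' - y)%R)%C by ring.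
  eapply Rle_lt_trans; [apply Cmod_triangle|]. rewrite Cmod_mult.
  pose proof (Cmod_le_sum (x' - x, y' - y)%R) as T; simpl in T.
  apply Rle_lt_trans with ((Rabs (x' - x) + Rabs (y' - y)) * (1 + Cmod b)); [nra|].
  apply Rmult_lt_compat_r with (r := 1 + Cmod b) in Hs; [|lra].
  replace (eps / (1 + Cmod b) * (1 + Cmod b)) with eps in Hs by (field; lra). exact Hs. }
assert (P : forall eps, 0 < eps -> 0 < Rmin d (eps / (1 + Cmod b))).
{ intros; apply Rmin_pos; [assumption | apply Rdiv_lt_0_compat; lra]. }
split; apply ccont_eps; intros eps He; exists (Rmin d (eps / (1 + Cmod b))); split; auto; intros s Hs;
  pose proof (Rmin_l d (eps / (1 + Cmod b))); pose proof (Rmin_r d (eps / (1 + Cmod b)));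
  apply Q; auto; unfold Rminus in *; rewrite ?Rplus_opp_r, ?Rabs_R0; lra.
Qed.

(** The contour integral of [h dz] counterclockwise around the boundary of the rectangle from
    [a + i c] to [b + i d]. *)
Definition rect_int (h : R -> R -> C) (a b c d : R) : C :=
  (CRInt (fun x => h x c) a b - CRInt (fun x => h x d) a b +
   Ci * (CRInt (fun y => h b y) c d - CRInt (fun y => h a y) c d))%C.

Lemma line_integrable (h : R -> R -> C) (a b c d : R) :
  (forall x y, a <= x <= b -> c <= y <= d -> hdiff h x y) ->
  (forall y u v, c <= y <= d -> a <= u -> u <= v -> v <= b -> integrable (fun x => h x y) u v) /\
  (forall x u v, a <= x <= b -> c <= u -> u <= v -> v <= d -> integrable (fun y => h x y) u v).
Proof.
intros H; split; intros z u v Hz H1 H2 H3; apply ccont_integrable; intros t Ht;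
  rewrite Rmin_left, Rmax_right in Ht by assumption.
- apply (hdiff_ccont h t z), H; lra.
- apply (hdiff_ccont h z t), H; lra.
Qed.

Lemma rect_int_split (h : R -> R -> C) (a m b c p d : R) : a <= m <= b -> c <= p <= d ->
  (forall x y, a <= x <= b -> c <= y <= d -> hdiff h x y) ->
  rect_int h a b c d = (rect_int h a m c p + rect_int h m b c p + rect_int h a m p d + rect_int h m b p d)%C.
Proof.
intros Hm Hp H. destruct (line_integrable h a b c d H) as [L1 L2]. unfold rect_int.
rewrite <- (CRInt_Chasles (fun x => h x c) a m b), <- (CRInt_Chasles (fun x => h x d) a m b) by (apply L1; lra).
rewrite <- (CRInt_Chasles (fun y => h a y) c p d), <- (CRInt_Chasles (fun y => h b y) c p d) by (apply L2; lra).
ring.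
Qed.

Lemma CRInt_lin (A B : C) (a b : R) :
  CRInt (fun t => A + B * RtoC t)%C a b = (A * RtoC (b - a) + B * RtoC ((b ^ 2 - a ^ 2) / 2))%C.
Proof.
assert (I : is_RInt (fun t => t) a b ((b ^ 2 - a ^ 2) / 2)).
{ replace ((b ^ 2 - a ^ 2) / 2) with (minus (b ^ 2 / 2) (a ^ 2 / 2)) by (unfold minus, plus, opp; simpl; field).
  apply (is_RInt_derive (fun t => t ^ 2 / 2) (fun t => t)).
  - intros x _; auto_derive; [trivial | field].
  - intros x _; apply continuous_id. }
assert (E : integrable (fun t => RtoC t) a b).
{ split; simpl; [eexists; exact I | apply ex_RInt_const]. }
assert (E' : integrable (fun _ => A) a b) by (split; apply ex_RInt_const).
rewrite (CRInt_plus (fun _ => A) (fun t => B * RtoC t)%C a b E' (integrable_scal B _ a b E)).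
rewrite CRInt_const, (CRInt_scal B (fun t => RtoC t) a b E).
replace (CRInt (fun t => RtoC t) a b) with (RtoC ((b ^ 2 - a ^ 2) / 2)); [ring|].
apply C_eq; simpl.
- symmetry; apply is_RInt_unique; exact I.
- rewrite RInt_const; unfold scal; simpl; unfold mult; simpl; ring.
Qed.

Lemma rect_int_affine (A B : C) (a b c d : R) : rect_int (fun x y => A + B * (x, y))%C a b c d = 0%C.
Proof.
unfold rect_int.
assert (X : forall y, CRInt (fun x => A + B * (x, y))%C a b =
   ((A + B * Ci * RtoC y) * RtoC (b - a) + B * RtoC ((b ^ 2 - a ^ 2) / 2))%C).
{ intros y; rewrite <- CRInt_lin; apply CRInt_ext; intros x.
  replace (x, y) with (RtoC x + Ci * RtoC y)%C by (apply C_eq; simpl; ring). ring. }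
assert (Y : forall x, CRInt (fun y => A + B * (x, y))%C c d =
   ((A + B * RtoC x) * RtoC (d - c) + B * Ci * RtoC ((d ^ 2 - c ^ 2) / 2))%C).
{ intros x; rewrite <- CRInt_lin; apply CRInt_ext; intros y.
  replace (x, y) with (RtoC x + Ci * RtoC y)%C by (apply C_eq; simpl; ring). ring. }
rewrite !X, !Y. destruct A, B. apply C_eq; simpl; field.
Qed.

Lemma CRInt_bound (F : R -> C) (B a b : R) : a <= b -> integrable F a b ->
  (forall t, a <= t <= b -> Cmod (F t) <= B) -> Cmod (CRInt F a b) <= (b - a) * B.
Proof.
intros Hab HF H. eapply Rle_trans; [apply (CRInt_norm F (fun _ => B)); auto; apply ex_RInt_const|].
rewrite RInt_const; unfold scal; simpl; unfold mult; simpl; lra.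
Qed.

Lemma integrable_ccont_lin (A B : C) (a b : R) : integrable (fun t => A + B * RtoC t)%C a b.
Proof.
apply ccont_integrable; intros t _. apply ccont_plus; [apply ccont_const|].
apply ccont_mult; [apply ccont_const|]. split; simpl; [apply continuous_id | apply continuous_const].
Qed.

(** Subtracting the affine function costs nothing by [rect_int_affine]; what remains is at most the
    perimeter times [eps]. *)
Lemma rect_int_small (h : R -> R -> C) (A B : C) (a b c d eps : R) : a <= b -> c <= d ->
  (forall x y, a <= x <= b -> c <= y <= d -> hdiff h x y) ->
  (forall x y, a <= x <= b -> c <= y <= d -> Cmod (h x y - (A + B * (x, y)))%C <= eps) ->
  Cmod (rect_int h a b c d) <= 2 * ((b - a) + (d - c)) * eps.
Proof.
intros Hab Hcd Hd H. destruct (line_integrable h a b c d Hd) as [L1 L2].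
assert (I1 : forall y, integrable (fun x => A + B * (x, y))%C a b).
{ intros y; replace (fun x => A + B * (x, y))%C with (fun x => (A + B * Ci * RtoC y) + B * RtoC x)%C.
  - apply integrable_ccont_lin.
  - apply functional_extensionality; intros x; apply C_eq; simpl; ring. }
assert (I2 : forall x, integrable (fun y => A + B * (x, y))%C c d).
{ intros x; replace (fun y => A + B * (x, y))%C with (fun y => (A + B * RtoC x) + B * Ci * RtoC y)%C.
  - apply integrable_ccont_lin.
  - apply functional_extensionality; intros y; apply C_eq; simpl; ring. }
assert (K1 : forall y, c <= y <= d ->
  Cmod (CRInt (fun x => h x y) a b - CRInt (fun x => A + B * (x, y)) a b)%C <= (b - a) * eps).
{ intros y Hy. rewrite <- CRInt_minus by (auto || apply L1; lra).
  apply CRInt_bound; [assumption | |intros; apply H; assumption].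
  apply integrable_plus; [apply L1; lra|].
  replace (fun x => - (A + B * (x, y)))%C with (fun x => RtoC (-1) * (A + B * (x, y)))%C;
    [apply integrable_scal, I1 | apply functional_extensionality; intros; apply C_eq; simpl; ring]. }
assert (K2 : forall x, a <= x <= b ->
  Cmod (CRInt (fun y => h x y) c d - CRInt (fun y => A + B * (x, y)) c d)%C <= (d - c) * eps).
{ intros x Hx. rewrite <- CRInt_minus by (auto || apply L2; lra).
  apply CRInt_bound; [assumption | |intros; apply H; assumption].
  apply integrable_plus; [apply L2; lra|].
  replace (fun y => - (A + B * (x, y)))%C with (fun y => RtoC (-1) * (A + B * (x, y)))%C;
    [apply integrable_scal, I2 | apply functional_extensionality; intros; apply C_eq; simpl; ring]. }
replace (rect_int h a b c d) with (rect_int h a b c d - rect_int (fun x y => A + B * (x, y))%C a b c d)%C by (rewrite rect_int_affine; ring).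
unfold rect_int.
set (p1 := CRInt (fun x => h x c) a b) in *. set (p2 := CRInt (fun x => h x d) a b) in *.
set (p3 := CRInt (fun y => h b y) c d) in *. set (p4 := CRInt (fun y => h a y) c d) in *.
assert (Q1 := K1 c ltac:(lra)). assert (Q2 := K1 d ltac:(lra)).
assert (Q3 := K2 b ltac:(lra)). assert (Q4 := K2 a ltac:(lra)).
set (q1 := CRInt (fun x => A + B * (x, c))%C a b) in *. set (q2 := CRInt (fun x => A + B * (x, d))%C a b) in *.
set (q3 := CRInt (fun y => A + B * (b, y))%C c d) in *. set (q4 := CRInt (fun y => A + B * (a, y))%C c d) in *.
replace (p1 - p2 + Ci * (p3 - p4) - (q1 - q2 + Ci * (q3 - q4)))%C
  with ((p1 - q1) + - (p2 - q2) + (Ci * (p3 - q3) + - (Ci * (p4 - q4))))%C by ring.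
eapply Rle_trans; [apply Cmod_triangle|].
eapply Rle_trans; [apply Rplus_le_compat; apply Cmod_triangle|].
rewrite !Cmod_opp, !Cmod_mult, Cmod_Ci. fold p1 p2 p3 p4 q1 q2 q3 q4 in Q1, Q2, Q3, Q4. lra.
Qed.

Definition rect : Type := (R * R * (R * R))%type.

Definition halving (q r : rect) : Prop :=
  let '(a, b, (c, d)) := q in let '(a', b', (c', d')) := r in
  a <= a' /\ b' <= b /\ c <= c' /\ d' <= d /\ b' - a' = (b - a) / 2 /\ d' - c' = (d - c) / 2.

Lemma nested_halving (q : nat -> rect) :
  (fst (fst (q O)) <= snd (fst (q O)) /\ fst (snd (q O)) <= snd (snd (q O))) ->
  (forall n, halving (q n) (q (S n))) ->
  exists x y, forall n, fst (fst (q n)) <= x <= snd (fst (q n)) /\ fst (snd (q n)) <= y <= snd (snd (q n)) /\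
    snd (fst (q n)) - fst (fst (q n)) = (snd (fst (q O)) - fst (fst (q O))) / 2 ^ n /\
    snd (snd (q n)) - fst (snd (q n)) = (snd (snd (q O)) - fst (snd (q O))) / 2 ^ n.
Proof.
intros [H1 H2] H.
assert (NI : forall u v : nat -> R, u O <= v O ->
  (forall n, u n <= u (S n) /\ v (S n) <= v n /\ v (S n) - u (S n) = (v n - u n) / 2) ->
  exists x, forall n, u n <= x <= v n /\ v n - u n = (v O - u O) / 2 ^ n).
{ clear; intros u v H0 H.
  assert (L : forall n, v n - u n = (v O - u O) / 2 ^ n).
  { induction n as [|n IH]; [simpl; field|].
    destruct (H n) as [_ [_ ->]]. rewrite IH; simpl; field; apply pow_nonzero; lra. }
  assert (P : forall n, u n <= v n).
  { intros n; specialize (L n).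
    assert (0 <= (v O - u O) / 2 ^ n) by (apply Rdiv_le_0_compat; [lra | apply pow_lt; lra]). lra. }
  assert (M : forall n k, u n <= u (n + k)%nat /\ v (n + k)%nat <= v n).
  { intros n; induction k as [|k [IH1 IH2]]; [rewrite Nat.add_0_r; lra|].
    rewrite Nat.add_succ_r; destruct (H (n + k)%nat) as [? [? _]]; lra. }
  assert (Q : forall m n, u m <= v n).
  { intros m n. destruct (M m n) as [M1 _]. destruct (M n m) as [_ M2].
    rewrite Nat.add_comm in M2. specialize (P (m + n)%nat); lra. }
  destruct (completeness (fun x => exists n, x = u n)) as [x [X1 X2]].
  - exists (v O); intros x [n ->]; apply Q.
  - exists (u O), O; reflexivity.
  - exists x; intros n; split; [split | apply L].
    + apply X1; exists n; reflexivity.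
    + apply X2; intros y [m ->]; apply Q. }
assert (HH : forall n, fst (fst (q n)) <= fst (fst (q (S n))) /\ snd (fst (q (S n))) <= snd (fst (q n)) /\
   snd (fst (q (S n))) - fst (fst (q (S n))) = (snd (fst (q n)) - fst (fst (q n))) / 2 /\
   fst (snd (q n)) <= fst (snd (q (S n))) /\ snd (snd (q (S n))) <= snd (snd (q n)) /\
   snd (snd (q (S n))) - fst (snd (q (S n))) = (snd (snd (q n)) - fst (snd (q n))) / 2).
{ intros n; specialize (H n). destruct (q n) as [[a b] [c d]], (q (S n)) as [[a' b'] [c' d']].
  simpl in *; tauto. }
destruct (NI (fun n => fst (fst (q n))) (fun n => snd (fst (q n))) H1) as [x Hx].
{ intros n; specialize (HH n); tauto. }
destruct (NI (fun n => fst (snd (q n))) (fun n => snd (snd (q n))) H2) as [y Hy].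
{ intros n; specialize (HH n); tauto. }
exists x, y; intros n; specialize (Hx n); specialize (Hy n); tauto.
Qed.

(** Bisection: [bad eps] means that the integral exceeds [eps] times the squared half-perimeter.
    Quartering divides that square by 4, so one of the four quarters stays bad. At the common point
    of a nested bad sequence differentiability gives the opposite inequality. *)
Lemma goursat (h : R -> R -> C) (a b c d : R) : a <= b -> c <= d ->
  (forall x y, a <= x <= b -> c <= y <= d -> hdiff h x y) -> rect_int h a b c d = 0%C.
Proof.
intros Hab Hcd H.
set (bad := fun eps (q : rect) => let '(a', b', (c', d')) := q in
   a <= a' /\ a' <= b' /\ b' <= b /\ c <= c' /\ c' <= d' /\ d' <= d /\
   eps * ((b' - a') + (d' - c')) ^ 2 < Cmod (rect_int h a' b' c' d')).
assert (step : forall eps q, bad eps q -> exists r, halving q r /\ bad eps r).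
{ intros eps [[a' b'] [c' d']] [B1 [B2 [B3 [B4 [B5 [B6 B7]]]]]].
  set (m := (a' + b') / 2). set (p := (c' + d') / 2).
  assert (Hm : a' <= m <= b') by (unfold m; lra). assert (Hp : c' <= p <= d') by (unfold p; lra).
  rewrite (rect_int_split h a' m b' c' p d') in B7 by (assumption || intros; apply H; lra).
  apply NNPP; intros N.
  assert (Q : forall u v s t, (u, v) = (a', m) \/ (u, v) = (m, b') -> (s, t) = (c', p) \/ (s, t) = (p, d') ->
     Cmod (rect_int h u v s t) <= eps * ((b' - a') + (d' - c')) ^ 2 / 4).
  { intros u v s t Huv Hst. apply Rnot_lt_le; intros K; apply N. exists (u, v, (s, t)).
    assert (U : a' <= u /\ v <= b' /\ v - u = (b' - a') / 2 /\ u <= v)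
      by (destruct Huv as [E|E]; injection E as -> ->; unfold m in *; lra).
    assert (V : c' <= s /\ t <= d' /\ t - s = (d' - c') / 2 /\ s <= t)
      by (destruct Hst as [E|E]; injection E as -> ->; unfold p in *; lra).
    destruct U as [? [? [U ?]]], V as [? [? [V ?]]].
    split; [simpl; repeat split; lra|]. simpl. do 6 (split; [lra|]).
    rewrite U, V. eapply Rle_lt_trans; [|exact K]. right; simpl; field. }
  assert (Q1 := Q a' m c' p (or_introl eq_refl) (or_introl eq_refl)).
  assert (Q2 := Q m b' c' p (or_intror eq_refl) (or_introl eq_refl)).
  assert (Q3 := Q a' m p d' (or_introl eq_refl) (or_intror eq_refl)).
  assert (Q4 := Q m b' p d' (or_intror eq_refl) (or_intror eq_refl)).
  pose proof (Cmod_triangle (rect_int h a' m c' p + rect_int h m b' c' p + rect_int h a' m p d')%C (rect_int h m b' p d')).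
  pose proof (Cmod_triangle (rect_int h a' m c' p + rect_int h m b' c' p)%C (rect_int h a' m p d')).
  pose proof (Cmod_triangle (rect_int h a' m c' p)%C (rect_int h m b' c' p)). lra. }
apply Cmod_eq_0. apply Rle_antisym; [|apply Cmod_ge_0].
assert (G : forall eps, 0 < eps -> Cmod (rect_int h a b c d) <= eps * ((b - a) + (d - c)) ^ 2).
{ intros eps He. apply Rnot_lt_le; intros K.
  (* The choice operator picks a bad quarter; its arbitrary default never occurs, since [step] keeps
     every [q n] bad. *)
  set (nxt := fun q => epsilon (inhabits q) (fun r => halving q r /\ bad eps r)).
  set (q := fun n => Nat.iter n nxt (a, b, (c, d))).
  assert (Hbad : forall n, bad eps (q n)).
  { induction n as [|n IH]; [simpl; do 6 (split; [lra|]); exact K|].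
    apply (epsilon_spec (inhabits (q n)) (fun r => halving (q n) r /\ bad eps r)), step, IH. }
  assert (Hch : forall n, halving (q n) (q (S n))).
  { intros n; apply (epsilon_spec (inhabits (q n)) (fun r => halving (q n) r /\ bad eps r)), step, Hbad. }
  destruct (nested_halving q) as [x [y Hxy]]; [simpl; lra | exact Hch|].
  assert (Hx : a <= x <= b /\ c <= y <= d) by (specialize (Hxy O); simpl in Hxy; tauto).
  destruct (H x y) as [B HB]; try tauto.
  (* With half-perimeter [l] the error is at most [eps/2 * l], and [rect_int_small] multiplies it by
     [2 l]: exactly the [eps * l^2] excluded by [bad]. *)
  destruct (HB (eps / 2) ltac:(lra)) as [del [Hdel HB']].
  set (L := (b - a) + (d - c)).
  destruct (pow_lt_1_zero (/ 2) ltac:(rewrite Rabs_pos_eq; lra) (del / (L + 1))) as [N HN].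
  { apply Rdiv_lt_0_compat; unfold L; lra. }
  specialize (HN N (le_n N)). specialize (Hxy N). specialize (Hbad N).
  rewrite Rabs_pos_eq in HN by (apply pow_le; lra).
  destruct (q N) as [[a' b'] [c' d']]. simpl in Hxy, Hbad.
  destruct Hbad as [B1 [B2 [B3 [B4 [B5 [B6 B7]]]]]]. destruct Hxy as [X1 [X2 [X3 X4]]].
  assert (HL : (b' - a') + (d' - c') < del).
  { rewrite X3, X4. replace ((b - a) / 2 ^ N + (d - c) / 2 ^ N) with (L * (/ 2) ^ N).
    2: { unfold L; rewrite pow_inv; field; apply pow_nonzero; lra. }
    apply Rmult_lt_compat_r with (r := L + 1) in HN; [|unfold L; lra].
    replace (del / (L + 1) * (L + 1)) with del in HN by (field; unfold L; lra).
    assert (0 <= (/ 2) ^ N) by (apply pow_le; lra). nra. }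
  apply Rlt_not_le in B7; apply B7.
  eapply Rle_trans; [apply (rect_int_small h (h x y - B * (x, y)) B a' b' c' d' (eps / 2 * ((b' - a') + (d' - c'))))|];
    try assumption.
  - intros; apply H; lra.
  - intros x' y' Hx' Hy'.
    replace (h x' y' - (h x y - B * (x, y) + B * (x', y')))%C with (h x' y' - h x y - B * (x' - x, y' - y)%R)%C
      by (apply C_eq; simpl; ring).
    assert (A1 : Rabs (x' - x) <= b' - a') by (apply Rabs_le; lra).
    assert (A2 : Rabs (y' - y) <= d' - c') by (apply Rabs_le; lra).
    eapply Rle_trans; [apply HB'; lra|]. apply Rmult_le_compat_l; lra.
  - right; field. }
apply le_epsilon; intros eps He. rewrite Rplus_0_l.
set (L := (b - a) + (d - c)) in *.
assert (P : 0 < L ^ 2 + 1) by (pose proof (pow2_ge_0 L); lra).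
eapply Rle_trans; [apply (G (eps / (L ^ 2 + 1))); apply Rdiv_lt_0_compat; assumption|].
apply Rmult_le_reg_r with (L ^ 2 + 1); [assumption|].
field_simplify; nra.
Qed.

(** * Complex differentiation and Taylor expansion *)

Definition cderiv (phi : C -> C) (a b : C) : Prop :=
  forall eps, 0 < eps -> exists del, 0 < del /\
    forall z, Cmod (z - a) < del -> Cmod (phi z - phi a - b * (z - a)) <= eps * Cmod (z - a).

Lemma ex_derive_cderiv (phi : C -> C) (a : C) :
  ex_derive (phi : C_AbsRing -> C_NormedModule) a -> exists b, cderiv phi a b.
Proof.
intros [b [_ H]]. exists b. intros eps He.
destruct (H a (fun P HP => HP) (mkposreal eps He)) as [d Hd].
exists d; split; [apply cond_pos|]. intros z Hz.
specialize (Hd z Hz). simpl in Hd.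
replace (phi z - phi a - b * (z - a))%C with (phi z - phi a - (z - a) * b)%C by ring. exact Hd.
Qed.

Lemma cderiv_continuous (phi : C -> C) (a b : C) : cderiv phi a b ->
  forall eps, 0 < eps -> exists del, 0 < del /\ forall z, Cmod (z - a) < del -> Cmod (phi z - phi a) <= eps.
Proof.
intros H eps He. destruct (H 1 Rlt_0_1) as [d [Hd K]].
pose proof (Cmod_ge_0 b) as Hb.
exists (Rmin d (eps / (1 + Cmod b))); split; [apply Rmin_pos; [assumption | apply Rdiv_lt_0_compat; lra]|].
intros z Hz. specialize (K z (Rlt_le_trans _ _ _ Hz (Rmin_l _ _))).
pose proof (Rlt_le_trans _ _ _ Hz (Rmin_r _ _)) as Hz'.
replace (phi z - phi a)%C with ((phi z - phi a - b * (z - a)) + b * (z - a))%C by ring.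
eapply Rle_trans; [apply Cmod_triangle|]. rewrite Cmod_mult.
apply Rmult_lt_compat_r with (r := 1 + Cmod b) in Hz'; [|lra].
replace (eps / (1 + Cmod b) * (1 + Cmod b)) with eps in Hz' by (field; lra). nra.
Qed.

Lemma cderiv_comp (f g : C -> C) (a bf bg : C) : cderiv g a bg -> cderiv f (g a) bf ->
  cderiv (fun z => f (g z)) a (bf * bg)%C.
Proof.
intros Hg Hf eps He.
pose proof (Cmod_ge_0 bf) as Pf; pose proof (Cmod_ge_0 bg) as Pg.
set (e1 := eps / 2 / (1 + Cmod bg)). set (e2 := Rmin 1 (eps / 2 / (1 + Cmod bf))).
assert (He1 : 0 < e1) by (apply Rdiv_lt_0_compat; lra).
assert (He2 : 0 < e2) by (apply Rmin_pos; [lra | apply Rdiv_lt_0_compat; lra]).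
destruct (Hf e1 He1) as [d1 [Hd1 K1]]. destruct (Hg e2 He2) as [d2 [Hd2 K2]].
destruct (cderiv_continuous g a bg Hg (d1 / 2) ltac:(lra)) as [d3 [Hd3 K3]].
exists (Rmin d2 d3); split; [apply Rmin_pos; assumption|]. intros z Hz.
specialize (K3 z (Rlt_le_trans _ _ _ Hz (Rmin_r _ _))).
specialize (K2 z (Rlt_le_trans _ _ _ Hz (Rmin_l _ _))).
specialize (K1 (g z) ltac:(lra)).
set (D := Cmod (z - a)) in *. assert (HD : 0 <= D) by apply Cmod_ge_0.
assert (G : Cmod (g z - g a) <= (1 + Cmod bg) * D).
{ replace (g z - g a)%C with ((g z - g a - bg * (z - a)) + bg * (z - a))%C by ring.
  eapply Rle_trans; [apply Cmod_triangle|]. rewrite Cmod_mult. fold D.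
  assert (e2 <= 1) by apply Rmin_l. nra. }
replace (f (g z) - f (g a) - bf * bg * (z - a))%C
  with ((f (g z) - f (g a) - bf * (g z - g a)) + bf * (g z - g a - bg * (z - a)))%C by ring.
eapply Rle_trans; [apply Cmod_triangle|]. rewrite Cmod_mult.
assert (A1 : e1 * Cmod (g z - g a) <= eps / 2 * D).
{ apply Rle_trans with (e1 * ((1 + Cmod bg) * D)); [apply Rmult_le_compat_l; lra|].
  right; unfold e1; field; lra. }
assert (A2 : Cmod bf * (e2 * D) <= eps / 2 * D).
{ assert (e2 <= eps / 2 / (1 + Cmod bf)) by apply Rmin_r.
  apply Rle_trans with ((1 + Cmod bf) * (eps / 2 / (1 + Cmod bf) * D)).
  - apply Rmult_le_compat; try nra.
  - right; field; lra. }
assert (Cmod bf * Cmod (g z - g a - bg * (z - a)) <= Cmod bf * (e2 * D)) by (apply Rmult_le_compat_l; assumption).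
lra.
Qed.

Lemma cderiv_mult (f g : C -> C) (a bf bg : C) : cderiv f a bf -> cderiv g a bg ->
  cderiv (fun z => f z * g z)%C a (bf * g a + f a * bg)%C.
Proof.
intros Hf Hg eps He.
pose proof (Cmod_ge_0 (f a)) as Pf; pose proof (Cmod_ge_0 (g a)) as Pg; pose proof (Cmod_ge_0 bf) as Pb.
set (e1 := eps / 3 / (2 + Cmod (g a))). set (e2 := eps / 3 / (1 + Cmod (f a))).
set (e3 := Rmin 1 (eps / 3 / (1 + Cmod bf))).
assert (He1 : 0 < e1) by (apply Rdiv_lt_0_compat; lra).
assert (He2 : 0 < e2) by (apply Rdiv_lt_0_compat; lra).
assert (He3 : 0 < e3) by (apply Rmin_pos; [lra | apply Rdiv_lt_0_compat; lra]).
destruct (Hf e1 He1) as [d1 [Hd1 K1]]. destruct (Hg e2 He2) as [d2 [Hd2 K2]].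
destruct (cderiv_continuous g a bg Hg e3 He3) as [d3 [Hd3 K3]].
exists (Rmin d1 (Rmin d2 d3)); split; [repeat first [assumption | apply Rmin_pos]|]. intros z Hz.
specialize (K1 z (Rlt_le_trans _ _ _ Hz (Rmin_l _ _))).
assert (Hz' := Rlt_le_trans _ _ _ Hz (Rmin_r _ _)).
specialize (K2 z (Rlt_le_trans _ _ _ Hz' (Rmin_l _ _))).
specialize (K3 z (Rlt_le_trans _ _ _ Hz' (Rmin_r _ _))).
set (D := Cmod (z - a)) in *. assert (HD : 0 <= D) by apply Cmod_ge_0.
assert (G : Cmod (g z) <= 1 + Cmod (g a)).
{ replace (g z) with ((g z - g a) + g a)%C by ring. eapply Rle_trans; [apply Cmod_triangle|].
  assert (e3 <= 1) by apply Rmin_l. lra. }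
replace (f z * g z - f a * g a - (bf * g a + f a * bg) * (z - a))%C with
  ((f z - f a - bf * (z - a)) * g z + f a * (g z - g a - bg * (z - a)) + bf * (z - a) * (g z - g a))%C by ring.
eapply Rle_trans; [apply Cmod_triangle|].
eapply Rle_trans; [apply Rplus_le_compat_r, Cmod_triangle|]. rewrite !Cmod_mult. fold D.
assert (A1 : Cmod (f z - f a - bf * (z - a)) * Cmod (g z) <= eps / 3 * D).
{ apply Rle_trans with (e1 * D * (2 + Cmod (g a))).
  - apply Rmult_le_compat; auto using Cmod_ge_0; lra.
  - right; unfold e1; field; lra. }
assert (A2 : Cmod (f a) * Cmod (g z - g a - bg * (z - a)) <= eps / 3 * D).
{ apply Rle_trans with ((1 + Cmod (f a)) * (e2 * D)).
  - apply Rmult_le_compat; auto using Cmod_ge_0; lra.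
  - right; unfold e2; field; lra. }
assert (A3 : Cmod bf * D * Cmod (g z - g a) <= eps / 3 * D).
{ assert (e3 <= eps / 3 / (1 + Cmod bf)) by apply Rmin_r.
  apply Rle_trans with ((1 + Cmod bf) * D * (eps / 3 / (1 + Cmod bf))).
  - apply Rmult_le_compat; try apply Cmod_ge_0; nra.
  - right; field; lra. }
lra.
Qed.

Lemma cderiv_affine (c b a : C) : cderiv (fun z => c + b * z)%C a b.
Proof.
intros eps He; exists 1; split; [lra|]. intros z _.
replace (c + b * z - (c + b * a) - b * (z - a))%C with (RtoC 0) by ring. rewrite Cmod_0.
pose proof (Cmod_ge_0 (z - a)); nra.
Qed.

Definition cexp (z : C) : C := (RtoC (exp (fst z)) * expi (snd z))%C.

Lemma cexp_plus (z w : C) : cexp (z + w) = (cexp z * cexp w)%C.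
Proof. unfold cexp; simpl. rewrite exp_plus, expi_plus, RtoC_mult; ring. Qed.

Lemma derivable_pt_lim_little_o (f : R -> R) (l : R) : derivable_pt_lim f 0 l ->
  forall eps, 0 < eps -> exists del, 0 < del /\
    forall x, Rabs x < del -> Rabs (f x - f 0 - l * x) <= eps * Rabs x.
Proof.
intros H eps He. destruct (H eps He) as [d Hd]. exists d; split; [apply cond_pos|]. intros x Hx.
destruct (Req_dec x 0) as [->|Hx0].
- replace (f 0 - f 0 - l * 0) with 0 by ring. rewrite Rabs_R0; lra.
- specialize (Hd x Hx0 Hx). rewrite Rplus_0_l in Hd.
  replace (f x - f 0 - l * x) with (((f x - f 0) / x - l) * x) by (field; assumption).
  rewrite Rabs_mult. apply Rmult_le_compat_r; [apply Rabs_pos | lra].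
Qed.

Lemma cexp_little_o (eps : R) : 0 < eps -> exists del, 0 < del /\
  forall z, Cmod z < del -> Cmod (cexp z - 1 - z) <= eps * Cmod z.
Proof.
(* The bounds [B1] to [B5] below add up to [7 h D], with [D] the modulus of [z]. *)
intros He. set (h := Rmin 1 (eps / 7)).
assert (Hh : 0 < h) by (apply Rmin_pos; lra).
destruct (derivable_pt_lim_little_o exp _ (derivable_pt_lim_exp 0) h Hh) as [d1 [Hd1 K1]].
destruct (derivable_pt_lim_little_o cos _ (derivable_pt_lim_cos 0) h Hh) as [d2 [Hd2 K2]].
destruct (derivable_pt_lim_little_o sin _ (derivable_pt_lim_sin 0) h Hh) as [d3 [Hd3 K3]].
exists (Rmin (Rmin d1 d2) (Rmin d3 h)); split; [repeat first [assumption | apply Rmin_pos]|].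
intros z Hz. pose proof (fst_le_Cmod z) as Z1; pose proof (snd_le_Cmod z) as Z2.
pose proof (Rlt_le_trans _ _ _ Hz (Rmin_l _ _)) as Ha. pose proof (Rlt_le_trans _ _ _ Hz (Rmin_r _ _)) as Hb.
pose proof (Rlt_le_trans _ _ _ Ha (Rmin_l _ _)) as H1. pose proof (Rlt_le_trans _ _ _ Ha (Rmin_r _ _)) as H2.
pose proof (Rlt_le_trans _ _ _ Hb (Rmin_l _ _)) as H3. pose proof (Rlt_le_trans _ _ _ Hb (Rmin_r _ _)) as H4.
destruct z as [u v]. cbn [fst snd] in Z1, Z2. set (D := Cmod (u, v)) in *.
specialize (K1 u ltac:(lra)). specialize (K2 v ltac:(lra)). specialize (K3 v ltac:(lra)).
rewrite exp_0 in K1. rewrite cos_0, sin_0 in K2. rewrite sin_0, cos_0 in K3.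
assert (Hh1 : h <= 1) by apply Rmin_l. assert (Hh2 : h <= eps / 7) by apply Rmin_r.
pose proof (Rabs_pos u) as U0; pose proof (Rabs_pos v) as V0.
eapply Rle_trans; [apply Cmod_le_sum|].
(* The term [- 0 * v] is the linear part of [cos] at 0, with slope [- sin 0], kept in this shape to
   match [K2]. *)
replace (fst (cexp (u, v) - 1 - (u, v))%C) with ((exp u - 1 - 1 * u) * cos v + (1 + u) * (cos v - 1 - - 0 * v))
  by (unfold cexp, expi; simpl; ring).
replace (snd (cexp (u, v) - 1 - (u, v))%C)
  with ((exp u - 1 - 1 * u) * sin v + (1 + u) * (sin v - 0 - 1 * v) + u * v)
  by (unfold cexp, expi; simpl; ring).
assert (Hc : Rabs (cos v) <= 1) by (apply Rabs_le; pose proof (COS_bound v); lra).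
assert (Hs : Rabs (sin v) <= 1) by (apply Rabs_le; pose proof (SIN_bound v); lra).
assert (H1u : Rabs (1 + u) <= 2) by (eapply Rle_trans; [apply Rabs_triang|]; rewrite Rabs_R1; lra).
eapply Rle_trans; [apply Rplus_le_compat;
  [apply Rabs_triang | eapply Rle_trans; [apply Rabs_triang | apply Rplus_le_compat_r, Rabs_triang]]|].
rewrite !Rabs_mult.
assert (B1 : Rabs (exp u - 1 - 1 * u) * Rabs (cos v) <= h * D * 1) by (apply Rmult_le_compat; try apply Rabs_pos; nra).
assert (B2 : Rabs (exp u - 1 - 1 * u) * Rabs (sin v) <= h * D * 1) by (apply Rmult_le_compat; try apply Rabs_pos; nra).
assert (B3 : Rabs (1 + u) * Rabs (cos v - 1 - - 0 * v) <= 2 * (h * D)) by (apply Rmult_le_compat; try apply Rabs_pos; nra).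
assert (B4 : Rabs (1 + u) * Rabs (sin v - 0 - 1 * v) <= 2 * (h * D)) by (apply Rmult_le_compat; try apply Rabs_pos; nra).
assert (B5 : Rabs u * Rabs v <= h * D) by (apply Rmult_le_compat; lra).
nra.
Qed.

Lemma cderiv_cexp (a : C) : cderiv cexp a (cexp a).
Proof.
intros eps He. pose proof (Cmod_ge_0 (cexp a)) as P.
destruct (cexp_little_o (eps / (1 + Cmod (cexp a)))) as [d [Hd K]]; [apply Rdiv_lt_0_compat; lra|].
exists d; split; [assumption|]. intros z Hz. specialize (K _ Hz).
replace (cexp z) with (cexp a * cexp (z - a))%C by (rewrite <- cexp_plus; f_equal; ring).
replace (cexp a * cexp (z - a) - cexp a - cexp a * (z - a))%C with (cexp a * (cexp (z - a) - 1 - (z - a)))%C by ring.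
rewrite Cmod_mult.
apply Rle_trans with ((1 + Cmod (cexp a)) * (eps / (1 + Cmod (cexp a)) * Cmod (z - a))).
- apply Rmult_le_compat; try apply Cmod_ge_0; lra.
- right; field; lra.
Qed.

Lemma cderiv_hdiff (psi : C -> C) (x y : R) (b : C) : cderiv psi (x, y) b -> hdiff (fun u v => psi (u, v)) x y.
Proof.
intros H; exists b; intros eps He. destruct (H eps He) as [d [Hd K]].
exists (d / 2); split; [lra|]. intros x' y' Hx Hy.
replace (x' - x, y' - y)%R with ((x', y') - (x, y))%C by (apply C_eq; simpl; ring).
assert (T : Cmod ((x', y') - (x, y))%C <= Rabs (x' - x) + Rabs (y' - y)) by exact (Cmod_le_sum ((x', y') - (x, y))%C).
eapply Rle_trans; [apply K; lra|]. apply Rmult_le_compat_l; lra.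
Qed.

(** * Fourier coefficients on circles and Taylor's formula *)

Definition holo_bd (phi : C -> C) (a : C) (r M : R) : Prop :=
  forall z, Cmod (z - a) < r -> (exists b, cderiv phi z b) /\ Cmod (phi z) <= M.

Definition circ (phi : C -> C) (a : C) (r t : R) : C := phi (a + RtoC r * expi t)%C.

Lemma circ_dist (a : C) (r t : R) : 0 <= r -> Cmod (a + RtoC r * expi t - a) = r.
Proof.
intros Hr; replace (a + RtoC r * expi t - a)%C with (RtoC r * expi t)%C by ring.
rewrite Cmod_mult, Cmod_expi, Cmod_R, Rabs_pos_eq by assumption; ring.
Qed.

Lemma ccont_cderiv (phi : C -> C) (F : R -> C) (t : R) (b : C) : ccont F t -> cderiv phi (F t) b ->
  ccont (fun x => phi (F x)) t.
Proof.
intros HF H; apply ccont_eps; intros eps He.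
destruct (cderiv_continuous phi (F t) b H (eps / 2) ltac:(lra)) as [d [Hd K]].
destruct (proj1 (ccont_eps F t) HF d Hd) as [d' [Hd' K']].
exists d'; split; [assumption|]. intros s Hs. specialize (K _ (K' s Hs)). lra.
Qed.

Lemma percont_circ (phi : C -> C) (a : C) (R0 M r : R) : holo_bd phi a R0 M -> 0 <= r < R0 -> percont (circ phi a r).
Proof.
intros H Hr; split; intros t; unfold circ.
- destruct (H (a + RtoC r * expi t)%C) as [[b Hb] _]; [rewrite circ_dist; lra|].
  apply (ccont_cderiv phi (fun t => a + RtoC r * expi t)%C t b); [|exact Hb].
  apply ccont_plus; [apply ccont_const|]. apply ccont_mult; [apply ccont_const | apply ccont_expi].
- rewrite <- (expi_period t 1), Rmult_1_r; reflexivity.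
Qed.

(* Goursat on the rectangle [[u0,u1] x [-pi,pi]] in the logarithmic coordinate [zeta = log (z - a)]:
   the horizontal sides cancel by periodicity. *)
Lemma fcoef_circ_indep (phi : C -> C) (a : C) (R0 M u0 u1 : R) (n : Z) : holo_bd phi a R0 M ->
  u0 <= u1 -> exp u1 < R0 ->
  (RtoC (exp (- IZR n * u0)) * fcoef (circ phi a (exp u0)) n = RtoC (exp (- IZR n * u1)) * fcoef (circ phi a (exp u1)) n)%C.
Proof.
intros H Hu Hu1.
(* The vertical side at abscissa [u] integrates to [2 pi exp(- n u)] times the coefficient on the
   circle of radius [exp u]. The idle [1 *] and [0 +] bring the inner maps into the form of
   [cderiv_affine]. *)
set (psi := fun z => (phi (a + 1 * cexp z) * cexp (0 + RtoC (- IZR n) * z))%C).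
set (h := fun u v => psi (u, v)).
assert (E : forall u v, h u v = (RtoC (exp (- IZR n * u)) * (circ phi a (exp u) v * expi (- IZR n * v)))%C).
{ intros u v; unfold h, psi, circ.
  replace (cexp (0 + RtoC (- IZR n) * (u, v)))%C with (RtoC (exp (- IZR n * u)) * expi (- IZR n * v))%C.
  - replace (a + 1 * cexp (u, v))%C with (a + RtoC (exp u) * expi v)%C by (unfold cexp; simpl; ring). ring.
  - unfold cexp; do 3 f_equal; simpl; ring. }
assert (HD : forall x y, u0 <= x <= u1 -> - PI <= y <= PI -> hdiff h x y).
{ intros x y Hx _.
  destruct (H (a + 1 * cexp (x, y))%C) as [[b Hb] _].
  { replace (a + 1 * cexp (x, y))%C with (a + RtoC (exp x) * expi y)%C by (unfold cexp; simpl; ring).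
    rewrite circ_dist by (left; apply exp_pos).
    apply Rle_lt_trans with (exp u1); [|assumption].
    destruct (Req_dec x u1) as [->|]; [lra | left; apply exp_increasing; lra]. }
  eapply cderiv_hdiff. unfold psi.
  apply (cderiv_mult (fun z => phi (a + 1 * cexp z))%C (fun z => cexp (0 + RtoC (- IZR n) * z))%C).
  - apply (cderiv_comp phi (fun z => a + 1 * cexp z)%C); [|exact Hb].
    apply (cderiv_comp (fun z => a + 1 * z)%C cexp); [apply cderiv_cexp | apply cderiv_affine].
  - apply (cderiv_comp cexp (fun z => 0 + RtoC (- IZR n) * z)%C); [apply cderiv_affine | apply cderiv_cexp]. }
assert (P : - PI <= PI) by (pose proof PI_RGT_0; lra).
pose proof (goursat h u0 u1 (- PI) PI Hu P HD) as G. unfold rect_int in G.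
assert (EH : forall x, h x (- PI) = h x PI).
{ intros x; rewrite 2!E. unfold circ.
  rewrite <- (expi_period (- PI) 1), <- (expi_period (- IZR n * - PI) (- n)).
  replace (- PI + 2 * 1 * PI) with PI by ring.
  replace (- IZR n * - PI + 2 * IZR (- n) * PI) with (- IZR n * PI) by (rewrite opp_IZR; ring).
  reflexivity. }
rewrite (CRInt_ext (fun x => h x (- PI)) (fun x => h x PI)) in G by assumption.
assert (V : forall u, u <= u1 -> CRInt (fun y => h u y) (- PI) PI =
   (RtoC (2 * PI) * (RtoC (exp (- IZR n * u)) * fcoef (circ phi a (exp u)) n))%C).
{ intros u Hux.
  assert (Hpc : percont (circ phi a (exp u))).
  { apply (percont_circ phi a R0 M); [assumption|]. split; [left; apply exp_pos|].
    apply Rle_lt_trans with (exp u1); [|assumption].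
    destruct (Req_dec u u1) as [->|]; [lra | left; apply exp_increasing; lra]. }
  rewrite (CRInt_ext _ _ _ _ (E u)).
  rewrite CRInt_scal.
  - unfold fcoef. rewrite !Cmult_assoc, (Cmult_comm (RtoC (2 * PI))), <- (Cmult_assoc _ (RtoC (2 * PI))), <- RtoC_mult.
    replace (2 * PI * / (2 * PI)) with 1 by (field; pose proof PI_RGT_0; lra). ring.
  - apply ccont_integrable; intros t _. apply ccont_mult; [apply Hpc | apply ccont_expi_scal]. }
rewrite !V in G by lra.
assert (P2 : 0 < 2 * PI) by (pose proof PI_RGT_0; lra).
set (A := (RtoC (exp (- IZR n * u0)) * fcoef (circ phi a (exp u0)) n)%C) in *.
set (B := (RtoC (exp (- IZR n * u1)) * fcoef (circ phi a (exp u1)) n)%C) in *.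
(* [G] now reads [X - X + i (2 pi B - 2 pi A) = 0]; comparing real and imaginary parts gives
   [A = B]. *)
clearbody A B. revert G; generalize (CRInt (fun x => h x PI) u0 u1); intros X G.
pose proof (f_equal fst G) as G1; pose proof (f_equal snd G) as G2. simpl in G1, G2.
apply C_eq; apply Rmult_eq_reg_l with (2 * PI); try (apply Rgt_not_eq; assumption); lra.
Qed.

Lemma fcoef_circ_scale (phi : C -> C) (a : C) (R0 M r s : R) (n : Z) : holo_bd phi a R0 M ->
  0 < r < R0 -> 0 < s < R0 ->
  (RtoC (exp (- IZR n * ln r)) * fcoef (circ phi a r) n = RtoC (exp (- IZR n * ln s)) * fcoef (circ phi a s) n)%C.
Proof.
intros H.
assert (W : forall r s, 0 < r < R0 -> 0 < s < R0 -> r <= s ->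
  (RtoC (exp (- IZR n * ln r)) * fcoef (circ phi a r) n = RtoC (exp (- IZR n * ln s)) * fcoef (circ phi a s) n)%C).
{ clear r s; intros r s Hr Hs Hrs.
  pose proof (fcoef_circ_indep phi a R0 M (ln r) (ln s) n H) as K. rewrite !exp_ln in K by lra.
  apply K; [|lra]. destruct (Req_dec r s) as [->|]; [lra | left; apply ln_increasing; lra]. }
intros Hr Hs. destruct (Rle_dec r s); [apply W | symmetry; apply W]; auto; lra.
Qed.

Lemma exp_mul_ln (r : R) (n : nat) : 0 < r -> exp (INR n * ln r) = r ^ n.
Proof.
intros Hr; induction n as [|n IH]; [simpl; rewrite Rmult_0_l; apply exp_0|].
rewrite S_INR, Rmult_plus_distr_r, exp_plus, IH, Rmult_1_l, exp_ln by assumption. simpl; ring.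
Qed.

Lemma fcoef_circ_bound (phi : C -> C) (a : C) (R0 M r : R) (n : Z) : holo_bd phi a R0 M -> 0 < r < R0 ->
  Cmod (fcoef (circ phi a r) n) <= M.
Proof.
intros H Hr; apply fcoef_bound; [apply (percont_circ phi a R0 M); auto; lra|].
intros t; apply (H (a + RtoC r * expi t)%C). rewrite circ_dist; lra.
Qed.

(** The coefficient times [r^n] does not depend on the radius, and on a circle of radius [s] it is
    at most [s^n M]; let [s] tend to 0. The bound on [phi] up to the centre is what excludes a
    principal part. *)
Lemma fcoef_circ_neg (phi : C -> C) (a : C) (R0 M r : R) (n : nat) : holo_bd phi a R0 M -> 0 < r < R0 -> (0 < n)%nat ->
  fcoef (circ phi a r) (- Z.of_nat n) = 0%C.
Proof.
intros H Hr Hn. destruct n as [|n]; [lia|].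
apply Cmod_eq_0, Rle_antisym; [|apply Cmod_ge_0].
assert (rp : 0 < r ^ S n) by (apply pow_lt; lra).
apply Rmult_le_reg_l with (r ^ S n); [assumption|]. rewrite Rmult_0_r.
assert (M0 : 0 <= M) by (eapply Rle_trans; [apply Cmod_ge_0 | apply (fcoef_circ_bound phi a R0 M r 0 H Hr)]).
apply le_epsilon; intros eps He. rewrite Rplus_0_l.
(* [s <= 1] reduces [s^(n+1)] to [s], and [M + 1] avoids dividing by a vanishing [M]. *)
set (s := Rmin (Rmin 1 (R0 / 2)) (eps / (M + 1))).
assert (S0 : 0 < s).
{ unfold s; repeat first [apply Rmin_pos | apply Rdiv_lt_0_compat | lra]. }
assert (S1 : s <= 1 /\ s <= R0 / 2 /\ s <= eps / (M + 1)).
{ unfold s; pose proof (Rmin_l (Rmin 1 (R0 / 2)) (eps / (M + 1))); pose proof (Rmin_r (Rmin 1 (R0 / 2)) (eps / (M + 1))).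
  pose proof (Rmin_l 1 (R0 / 2)); pose proof (Rmin_r 1 (R0 / 2)). lra. }
assert (Hs : 0 < s < R0) by lra.
pose proof (fcoef_circ_scale phi a R0 M r s (- Z.of_nat (S n)) H Hr Hs) as K.
rewrite opp_IZR, <- INR_IZR_INZ, Ropp_involutive, !exp_mul_ln in K by lra.
apply (f_equal Cmod) in K. rewrite !Cmod_mult, !Cmod_R in K.
rewrite (Rabs_pos_eq (r ^ S n)) in K by lra.
rewrite (Rabs_pos_eq (s ^ S n)) in K by (apply pow_le; lra).
rewrite K. pose proof (fcoef_circ_bound phi a R0 M s (- Z.of_nat (S n)) H Hs) as B.
apply Rle_trans with (s * M).
- apply Rmult_le_compat; try apply Cmod_ge_0; [apply pow_le; lra | | assumption].
  simpl. assert (s ^ n <= 1) by (rewrite <- (pow1 n); apply pow_incr; lra). nra.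
- apply Rle_trans with (eps / (M + 1) * M); [nra|].
  apply Rmult_le_reg_r with (M + 1); [lra|]. field_simplify; nra.
Qed.

Lemma fcoef_circ_pos (phi : C -> C) (a : C) (R0 M r s : R) (n : nat) : holo_bd phi a R0 M ->
  0 < r < R0 -> 0 < s < R0 ->
  fcoef (circ phi a r) (Z.of_nat n) = (RtoC (r ^ n / s ^ n) * fcoef (circ phi a s) (Z.of_nat n))%C.
Proof.
intros H Hr Hs. pose proof (fcoef_circ_scale phi a R0 M r s (Z.of_nat n) H Hr Hs) as K.
rewrite <- INR_IZR_INZ in K.
replace (- INR n * ln r) with (- (INR n * ln r)) in K by ring.
replace (- INR n * ln s) with (- (INR n * ln s)) in K by ring.
rewrite !exp_Ropp, !exp_mul_ln in K by lra.
assert (r ^ n <> 0) by (apply pow_nonzero; lra). assert (s ^ n <> 0) by (apply pow_nonzero; lra).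
replace (fcoef (circ phi a r) (Z.of_nat n)) with (RtoC (r ^ n) * (RtoC (/ r ^ n) * fcoef (circ phi a r) (Z.of_nat n)))%C.
- rewrite K, Cmult_assoc, <- RtoC_mult; reflexivity.
- rewrite Cmult_assoc, <- RtoC_mult, Rinv_r by assumption; ring.
Qed.

(** The usual [phi^(k)(a) / k!], with the same value for all admissible [r] by [fcoef_circ_pos]. As
    an average over a circle it lets differences in the centre [a] pass inside. *)
Definition taylor_coef (phi : C -> C) (a : C) (r : R) (k : nat) : C :=
  (fcoef (circ phi a r) (Z.of_nat k) * RtoC (/ r ^ k))%C.

Lemma taylor_coef_bound (phi : C -> C) (a : C) (R0 M r : R) (k : nat) : holo_bd phi a R0 M -> 0 < r < R0 ->
  Cmod (taylor_coef phi a r k) <= M / r ^ k.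
Proof.
intros H Hr. unfold taylor_coef, Rdiv. assert (0 < / r ^ k) by (apply Rinv_0_lt_compat, pow_lt; lra).
rewrite Cmod_mult, Cmod_R, Rabs_pos_eq by lra.
apply Rmult_le_compat_r; [lra | apply (fcoef_circ_bound phi a R0 M); assumption].
Qed.

(** The mean value property: the mean over a circle is independent of its radius, and shrinking
    circles give [phi a] by continuity. *)
Lemma taylor_coef_0 (phi : C -> C) (a : C) (R0 M r : R) : holo_bd phi a R0 M -> 0 < r < R0 ->
  taylor_coef phi a r 0 = phi a.
Proof.
intros H Hr. unfold taylor_coef. simpl. rewrite Rinv_1, Cmult_1_r.
replace (fcoef (circ phi a r) 0) with ((fcoef (circ phi a r) 0 - phi a) + phi a)%C by ring.
replace (fcoef (circ phi a r) 0 - phi a)%C with (RtoC 0); [ring|]. symmetry.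
apply Cmod_eq_0, Rle_antisym; [|apply Cmod_ge_0].
apply le_epsilon; intros eps He. rewrite Rplus_0_l.
destruct (H a) as [[b Hb] _]; [replace (a - a)%C with (RtoC 0) by ring; rewrite Cmod_0; lra|].
destruct (cderiv_continuous phi a b Hb eps He) as [d [Hd K]].
set (s := Rmin (d / 2) (R0 / 2)).
assert (S1 : 0 < s /\ s <= d / 2 /\ s <= R0 / 2) by (split; [apply Rmin_pos; lra | split; [apply Rmin_l | apply Rmin_r]]).
assert (Hs : 0 < s < R0) by lra.
assert (Hp : percont (circ phi a s)) by (apply (percont_circ phi a R0 M); auto; lra).
pose proof (fcoef_circ_pos phi a R0 M r s 0 H Hr Hs) as E. simpl in E.
replace (1 / 1) with 1 in E by field. rewrite Cmult_1_l in E. rewrite E.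
assert (E2 : phi a = fcoef (fun _ => phi a) 0).
{ rewrite fcoef_mean, (mean_ext _ (fun _ => phi a)); [symmetry; apply mean_const|].
  intros t; simpl; rewrite character_0; ring. }
rewrite E2, <- fcoef_minus by (assumption || apply percont_const).
apply fcoef_bound; [apply percont_minus; [assumption | apply percont_const]|].
intros t; unfold circ; apply K. rewrite circ_dist; lra.
Qed.

Lemma expi_surj (z : C) : Cmod z = 1 -> exists t, z = expi t.
Proof.
intros H. destruct z as [x y].
assert (E : x ^ 2 + y ^ 2 = 1).
{ pose proof (Cmod2_alt (x, y)) as K. rewrite H in K. unfold Re, Im in K; simpl in K. simpl; lra. }
assert (X : -1 <= x <= 1) by nra.
assert (S : sqrt (1 - Rsqr x) = Rabs y).
{ replace (1 - Rsqr x) with (Rsqr y) by (unfold Rsqr; nra). apply sqrt_Rsqr_abs. }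
destruct (Rle_dec 0 y) as [Y|Y].
- exists (acos x). unfold expi. rewrite cos_acos, sin_acos, S, Rabs_pos_eq by assumption. reflexivity.
- exists (- acos x). unfold expi. rewrite cos_neg, sin_neg, cos_acos, sin_acos, S, Rabs_left by lra.
  rewrite Ropp_involutive; reflexivity.
Qed.

Lemma polar (z : C) : exists t, z = (RtoC (Cmod z) * expi t)%C.
Proof.
destruct (Req_dec (Cmod z) 0) as [Z|Z].
- exists 0. rewrite Z. rewrite (Cmod_eq_0 z Z). ring.
- assert (RtoC (Cmod z) <> 0%C) by (intros K; apply Z; injection K; auto).
  destruct (expi_surj (z / RtoC (Cmod z))%C) as [t Ht].
  + rewrite Cmod_div, Cmod_R, Rabs_pos_eq by (assumption || apply Cmod_ge_0). field; assumption.
  + exists t; rewrite <- Ht; field; assumption.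
Qed.

Lemma csum_map {A B} (g : A -> B) (l : list A) (u : B -> C) : csum (map g l) u = csum l (fun x => u (g x)).
Proof. induction l as [|a l IH]; simpl; [reflexivity|]. rewrite IH; reflexivity. Qed.

Lemma expi_pow (t : R) (k : nat) : (expi t ^ k)%C = character (Z.of_nat k) t.
Proof.
induction k as [|k IH]; [simpl; rewrite character_0; reflexivity|].
rewrite Cpow_S, IH. replace (Z.of_nat (S k)) with (1 + Z.of_nat k)%Z by lia.
rewrite <- character_mult. f_equal. unfold character; f_equal; ring.
Qed.

Lemma zseq_geometric (u : Z -> R) (M q : R) (N K : nat) : 0 <= M -> 0 <= q < 1 ->
  (forall n, (n < N)%nat -> u (Z.of_nat n) <= 0) -> (forall n, u (Z.of_nat n) <= M * q ^ n) ->
  rsum (zseq K) u <= M * q ^ N / (1 - q).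
Proof.
intros HM Hq H1 H2.
(* The maximum makes the partial geometric sum empty as long as [K <= N]. *)
assert (Q : rsum (zseq K) u <= M * (q ^ N - q ^ (Nat.max N K)) / (1 - q)).
{ induction K as [|K IH].
  - simpl. rewrite Nat.max_0_r. right; field; lra.
  - rewrite zseq_S, rsum_app. cbn [rsum]. destruct (Nat.lt_ge_cases K N) as [L|L].
    + specialize (H1 K L). replace (Nat.max N (S K)) with (Nat.max N K) by lia. lra.
    + specialize (H2 K). rewrite Nat.max_r in IH by lia. rewrite Nat.max_r by lia.
      replace (M * (q ^ N - q ^ S K) / (1 - q)) with (M * (q ^ N - q ^ K) / (1 - q) + M * q ^ K) by (simpl; field; lra).
      lra. }
eapply Rle_trans; [exact Q|]. apply Rmult_le_compat_r; [left; apply Rinv_0_lt_compat; lra|].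
apply Rmult_le_compat_l; [assumption|]. pose proof (pow_le q (Nat.max N K) (proj1 Hq)). lra.
Qed.

(** On the circle through [a + w] the Taylor polynomial is the partial Fourier sum over the
    frequencies below [N]. The remaining coefficients vanish at negative frequencies and are at most
    [M (|w|/r)^n] otherwise, so [wnorm_le_sup] bounds the remainder pointwise by a geometric
    tail. *)
Lemma taylor (phi : C -> C) (a w : C) (R0 M r : R) (N : nat) : holo_bd phi a R0 M -> 0 < r < R0 ->
  Cmod w < r -> (0 < N)%nat ->
  Cmod (phi (a + w) - csum (seq 0 N) (fun k => taylor_coef phi a r k * w ^ k))%C <=
    M * (Cmod w / r) ^ N / (1 - Cmod w / r).
Proof.
intros H Hr Hw HN.
assert (M0 : 0 <= M) by (eapply Rle_trans; [apply Cmod_ge_0 | apply (fcoef_circ_bound phi a R0 M r 0 H Hr)]).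
set (s := Cmod w) in *. assert (S0 : 0 <= s) by apply Cmod_ge_0.
assert (Hq : 0 <= s / r < 1).
{ split; [apply Rdiv_le_0_compat; lra|]. apply Rmult_lt_reg_r with r; [lra|]. field_simplify; lra. }
assert (R1 : 0 <= M * (s / r) ^ N / (1 - s / r)).
{ apply Rdiv_le_0_compat; [|lra]. apply Rmult_le_pos; [assumption | apply pow_le; lra]. }
destruct (Req_dec s 0) as [Z|Z].
- assert (W : w = 0%C) by (apply Cmod_eq_0; exact Z). subst w.
  destruct N as [|N]; [lia|]. simpl csum. rewrite (taylor_coef_0 phi a R0 M) by assumption.
  rewrite (csum_ext _ _ (fun _ => 0%C)).
  + rewrite csum_const.
    replace (phi (a + 0) - (phi a * 1 + RtoC (INR (length (seq 1 N))) * 0))%C with (RtoC 0);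
      [rewrite Cmod_0; assumption|].
    replace (a + 0)%C with a by ring. ring.
  + intros k Hk. apply in_seq in Hk. destruct k as [|k]; [lia|]. rewrite Cpow_S; ring.
- assert (Hs : 0 < s < R0) by lra.
  destruct (polar w) as [t Ht]. fold s in Ht.
  set (F := circ phi a s).
  assert (HF : percont F) by (apply (percont_circ phi a R0 M); auto; lra).
  assert (E : (phi (a + w) - csum (seq 0 N) (fun k => taylor_coef phi a r k * w ^ k) = F t - psum F (zseq N) t)%C).
  { unfold F at 1, circ. rewrite Ht. f_equal. f_equal. unfold psum, zseq. rewrite csum_map.
    apply csum_ext; intros k _. unfold F. rewrite (fcoef_circ_pos phi a R0 M s r k H Hs Hr).
    unfold taylor_coef, Rdiv. rewrite Cpow_mult_l, expi_pow, <- RtoC_pow, RtoC_mult. ring. }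
  rewrite E.
  apply (wnorm_le_sup (fun t => F t - psum F (zseq N) t)%C). split; [apply percont_minus; [assumption | apply percont_psum]|].
  intros l Hl. apply NoDup_rsum_Z; [intros; apply Cmod_ge_0 | | assumption]. intros K.
  assert (C1 : forall n, fcoef (fun t => F t - psum F (zseq N) t)%C n =
     if in_dec Z.eq_dec n (zseq N) then 0%C else fcoef F n).
  { intros n. rewrite fcoef_minus, fcoef_psum by (assumption || apply percont_psum || apply NoDup_zseq).
    destruct (in_dec Z.eq_dec n (zseq N)); ring. }
  assert (IN : forall n : nat, (n < N)%nat -> In (Z.of_nat n) (zseq N)).
  { intros n Hn; apply in_map, in_seq; lia. }
  rewrite <- (Rplus_0_r (M * (s / r) ^ N / (1 - s / r))). apply Rplus_le_compat.
  + apply zseq_geometric; try assumption.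
    * intros n Hn. rewrite C1. destruct (in_dec Z.eq_dec (Z.of_nat n) (zseq N)) as [_|rect_int]; [rewrite Cmod_0; lra|].
      destruct rect_int; apply IN, Hn.
    * intros n. rewrite C1. pose proof (pow_le (s / r) n (proj1 Hq)) as Pq.
      destruct (in_dec Z.eq_dec (Z.of_nat n) (zseq N)); [rewrite Cmod_0; nra|].
      unfold F. rewrite (fcoef_circ_pos phi a R0 M s r n H Hs Hr), Cmod_mult, Cmod_R.
      replace (s ^ n / r ^ n) with ((s / r) ^ n).
      2: { unfold Rdiv; rewrite Rpow_mult_distr, pow_inv; reflexivity. }
      rewrite Rabs_pos_eq, Rmult_comm by assumption.
      apply Rmult_le_compat_r; [assumption | apply (fcoef_circ_bound phi a R0 M); assumption].
  + apply Rle_trans with (rsum (zseq K) (fun _ => 0)); [|rewrite rsum_const; lra].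
    apply rsum_le; intros n Hn. rewrite C1.
    destruct (in_dec Z.eq_dec (- n)%Z (zseq N)) as [_|rect_int]; [rewrite Cmod_0; lra|].
    apply in_map_iff in Hn as [m [<- _]]. destruct m as [|m].
    (* Index 0 recurs in the negative half; [0 < N] places it among the removed frequencies. *)
    * destruct rect_int. apply (IN O HN).
    * unfold F; rewrite (fcoef_circ_neg phi a R0 M s (S m) H Hs) by lia. rewrite Cmod_0; lra.
Qed.

(** * The Wiener-Levy theorem *)

(** Compactness of one period yields a single positive lower bound [d] for a gauge. Hence one number
    [h] per point governs radius, bound and gauge at once, and [d] and [/ d] serve as the uniform
    radius and bound. *)
Lemma uniform_holo_bd (F : R -> C) (phi : C -> C) (U : C -> Prop) : percont F -> open U -> (forall t, U (F t)) ->
  (forall w, U w -> exists b, cderiv phi w b) ->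
  exists R0 M, 0 < R0 /\ forall t, holo_bd phi (F t) R0 M.
Proof.
intros HF HU HFU Hphi.
assert (D : forall t, { d : posreal | exists h : R, d <= h /\
   (forall w, Cmod (w - F t) < 2 * h -> U w /\ Cmod (phi w) <= / h) /\
   (forall s, Rabs (s - t) < d -> Cmod (F s - F t) < h) }).
{ intros t. apply constructive_indefinite_description.
  destruct (HU (F t) (HFU t)) as [e1 He1].
  destruct (Hphi (F t) (HFU t)) as [b Hb].
  destruct (cderiv_continuous phi (F t) b Hb 1 Rlt_0_1) as [d2 [Hd2 K2]].
  pose proof (Cmod_ge_0 (phi (F t))) as P0. pose proof (cond_pos e1) as Pe.
  (* The halves keep the disc of radius [2 h] inside [U] and inside the disc where [phi] moves by at
     most 1; the last entry turns the resulting bound into [/ h]. *)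
  set (h := Rmin (Rmin (e1 / 2) (d2 / 2)) (/ (Cmod (phi (F t)) + 1))).
  assert (Hh : 0 < h) by (unfold h; repeat apply Rmin_pos; try lra; apply Rinv_0_lt_compat; lra).
  assert (B3 : h <= e1 / 2 /\ h <= d2 / 2 /\ h <= / (Cmod (phi (F t)) + 1)).
  { unfold h; pose proof (Rmin_l (Rmin (e1 / 2) (d2 / 2)) (/ (Cmod (phi (F t)) + 1))).
    pose proof (Rmin_r (Rmin (e1 / 2) (d2 / 2)) (/ (Cmod (phi (F t)) + 1))).
    pose proof (Rmin_l (e1 / 2) (d2 / 2)); pose proof (Rmin_r (e1 / 2) (d2 / 2)). lra. }
  destruct (proj1 (ccont_eps F t) (proj1 HF t) h Hh) as [d4 [Hd4 K4]].
  assert (Hd : 0 < Rmin h d4) by (apply Rmin_pos; assumption).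
  exists (mkposreal _ Hd), h. simpl. split; [apply Rmin_l | split].
  - intros w Hw. split.
    + apply He1, C_NormedModule_mixin_compat1. apply Rlt_le_trans with (2 * h); [exact Hw | lra].
    + specialize (K2 w ltac:(lra)).
      replace (phi w) with ((phi w - phi (F t)) + phi (F t))%C by ring.
      eapply Rle_trans; [apply Cmod_triangle|].
      apply Rle_trans with (/ / (Cmod (phi (F t)) + 1)); [rewrite Rinv_inv; lra|].
      apply Rinv_le_contravar; lra.
  - intros s Hs; apply K4. eapply Rlt_le_trans; [exact Hs | apply Rmin_r]. }
destruct (compactness_value_1d (- PI) PI (fun t => proj1_sig (D t))) as [d Hd].
pose proof (cond_pos d) as Pd.
exists d, (/ d). split; [assumption|].
assert (Q : forall t, - PI <= t <= PI -> holo_bd phi (F t) d (/ d)).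
{ intros t Ht w Hw. apply NNPP; intros N. apply (Hd t Ht). intros [s [_ [Hs1 Hs2]]]. apply N.
  destruct (D s) as [ds [h [Hh [K1 K2]]]]. simpl in Hs1, Hs2.
  specialize (K2 t Hs1).
  destruct (K1 w) as [W1 W2].
  - replace (w - F s)%C with ((w - F t) + (F t - F s))%C by ring.
    eapply Rle_lt_trans; [apply Cmod_triangle|]. lra.
  - split; [apply Hphi, W1|]. eapply Rle_trans; [exact W2|]. apply Rinv_le_contravar; lra. }
intros t. destruct (period_reduce t) as [k Hk]. rewrite <- (per_Z F HF k t). apply Q, Hk.
Qed.

(** * Difference estimates for [phi] and for trigonometric polynomials *)

Lemma holo_bd_sub (phi : C -> C) (a b : C) (R0 R1 M : R) : holo_bd phi a R0 M -> Cmod (b - a) + R1 <= R0 ->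
  holo_bd phi b R1 M.
Proof.
intros H HR w Hw. apply H. replace (w - a)%C with ((w - b) + (b - a))%C by ring.
eapply Rle_lt_trans; [apply Cmod_triangle|]. lra.
Qed.

(** Large [x] must be covered, since [wnorm_le_second_difference] asks for all shifts. If
    [|x| <= k/2], Taylor's formula gives the factor 2. Otherwise [q = |x|/k] exceeds 1/2, and the
    trivial bound [2 M + M q] is at most [8 M q^2 + 2 M q^2]. *)
Lemma second_order (phi : C -> C) (z x : C) (k M : R) : 0 < k -> holo_bd phi z (2 * k) M -> Cmod (phi (z + x)%C) <= M ->
  Cmod (phi (z + x)%C - phi z - taylor_coef phi z k 1 * x) <= 10 * M / k ^ 2 * Cmod x ^ 2.
Proof.
intros Hk H Hx.
assert (Hk' : 0 < k < 2 * k) by lra.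
assert (M0 : 0 <= M) by (eapply Rle_trans; [apply Cmod_ge_0 | exact Hx]).
pose proof (Cmod_ge_0 x) as X0.
assert (P : 0 <= M / k ^ 2 * Cmod x ^ 2).
{ apply Rmult_le_pos; [apply Rdiv_le_0_compat; [assumption | apply pow_lt; assumption] | apply pow_le; assumption]. }
destruct (Rle_dec (Cmod x) (k / 2)) as [L|L].
- pose proof (taylor phi z x (2 * k) M k 2 H Hk' ltac:(lra) ltac:(lia)) as T.
  simpl csum in T. rewrite (taylor_coef_0 phi z (2 * k) M k H Hk') in T.
  replace (phi (z + x) - phi z - taylor_coef phi z k 1 * x)%C with
    (phi (z + x) - (phi z * 1 + (taylor_coef phi z k 1 * (x * 1) + 0)))%C by ring.
  eapply Rle_trans; [exact T|].
  assert (Q : / (1 - Cmod x / k) <= 2).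
  { rewrite <- (Rinv_inv 2). apply Rinv_le_contravar; [lra|].
    assert (Cmod x / k <= / 2); [|lra]. apply Rmult_le_reg_r with k; [assumption|]. field_simplify; lra. }
  apply Rle_trans with (M * (Cmod x / k) ^ 2 * 2).
  + apply Rmult_le_compat_l; [|exact Q]. apply Rmult_le_pos; [assumption | apply pow2_ge_0].
  + replace (M * (Cmod x / k) ^ 2 * 2) with (2 * (M / k ^ 2 * Cmod x ^ 2)) by (field; lra).
    replace (10 * M / k ^ 2 * Cmod x ^ 2) with (10 * (M / k ^ 2 * Cmod x ^ 2)) by (field; lra). lra.
- assert (Z : Cmod (phi z) <= M) by (apply (H z); replace (z - z)%C with (RtoC 0) by ring; rewrite Cmod_0; lra).
  pose proof (taylor_coef_bound phi z (2 * k) M k 1 H Hk') as T. rewrite pow_1 in T.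
  unfold Cminus. eapply Rle_trans; [apply Cmod_triangle|].
  eapply Rle_trans; [apply Rplus_le_compat_r, Cmod_triangle|]. rewrite !Cmod_opp, Cmod_mult.
  set (q := Cmod x / k). assert (Eq : Cmod x = q * k) by (unfold q; field; lra).
  assert (Q : / 2 < q) by (apply Rmult_lt_reg_r with k; [assumption|]; unfold q; field_simplify; lra).
  apply Rle_trans with (M + M + M * q).
  + apply Rplus_le_compat; [lra|]. apply Rle_trans with (M / k * Cmod x); [apply Rmult_le_compat_r; assumption|].
    right; unfold q; field; lra.
  + replace (10 * M / k ^ 2 * Cmod x ^ 2) with (10 * M * q ^ 2) by (unfold q; field; lra).
    assert (1 <= 4 * q ^ 2) by nra. assert (q <= 2 * q ^ 2) by nra. nra.
Qed.

Lemma two_minus_two_cos (x : R) : 0 <= 2 - 2 * cos x <= x ^ 2.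
Proof.
split; [pose proof (COS_bound x); lra|].
assert (S : forall y, 0 <= y -> sin y ^ 2 <= y ^ 2).
{ intros y Hy. destruct (Req_dec y 0) as [->|Hy0]; [rewrite sin_0; lra|].
  destruct (Rle_dec 1 y) as [L|L].
  - pose proof (SIN_bound y). apply Rle_trans with 1; nra.
  - pose proof (sin_lt_x y ltac:(lra)). pose proof PI2_1.
    assert (0 <= sin y) by (apply sin_ge_0; lra). apply pow_incr; lra. }
pose proof (cos_2a_sin (x / 2)) as C. replace (2 * (x / 2)) with x in C by field.
assert (T : sin (x / 2) ^ 2 <= (x / 2) ^ 2).
{ destruct (Rle_dec 0 (x / 2)) as [L|L]; [apply S; assumption|].
  pose proof (S (- (x / 2)) ltac:(lra)) as K. rewrite sin_neg in K. nra. }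
rewrite C. nra.
Qed.

Lemma character_first_difference (k : Z) (t s : R) : Cmod (character k (t + s) - character k t) <= Rabs (IZR k) * Rabs s.
Proof.
rewrite character_shift. replace (character k s * character k t - character k t)%C with (- (character k t * (1 - character k s)))%C by ring.
rewrite Cmod_opp, Cmod_mult, Cmod_character, Rmult_1_l, <- Rabs_mult.
replace (character k s) with (character 1 (IZR k * s)) by (unfold character; f_equal; ring).
apply Rsqr_incr_0; [|apply Cmod_ge_0 | apply Rabs_pos].
rewrite <- Rsqr_abs, !Rsqr_pow2, Cmod_one_sub_character. apply two_minus_two_cos.
Qed.

Lemma character_second_difference (k : Z) (t s : R) :
  Cmod (character k (t + s) + character k (t - s) - 2 * character k t) <= IZR k ^ 2 * s ^ 2.
Proof.
unfold Rminus. rewrite 2!character_shift.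
replace (character k s * character k t + character k (- s) * character k t - 2 * character k t)%C with (character k t * RtoC (2 * cos (IZR k * s) - 2))%C.
- rewrite Cmod_mult, Cmod_character, Rmult_1_l, Cmod_R, <- Rpow_mult_distr.
  destruct (two_minus_two_cos (IZR k * s)) as [H1 H2]. rewrite Rabs_left1 by lra. lra.
- replace (2 * cos (IZR k * s) - 2)%R with (cos (IZR k * s) + cos (IZR k * s) - 2)%R by ring.
  unfold character, expi. rewrite <- Ropp_mult_distr_r, cos_neg, sin_neg. apply C_eq; simpl; ring.
Qed.

Lemma psum_differences (F : R -> C) (l : list Z) : exists L, 0 <= L /\
  (forall t s, Cmod (psum F l (t + s) - psum F l t) <= L * Rabs s) /\
  (forall t s, Cmod (psum F l (t + s) + psum F l (t - s) - 2 * psum F l t) <= L * s ^ 2).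
Proof.
unfold psum. induction l as [|k l [L [L0 [L1 L2]]]].
- exists 0; split; [lra|]. split; intros t s; simpl;
    [replace (0 - 0)%C with (RtoC 0) by ring | replace (0 + 0 - 2 * 0)%C with (RtoC 0) by ring]; rewrite Cmod_0; lra.
- pose proof (Cmod_ge_0 (fcoef F k)) as A0. set (A := Cmod (fcoef F k)) in *.
  pose proof (Rabs_pos (IZR k)) as K0. pose proof (pow2_ge_0 (IZR k)) as K2.
  (* One constant for both estimates: [|k|] pays for the first difference, [k^2] for the second. *)
  exists (A * (Rabs (IZR k) + IZR k ^ 2) + L).
  split; [|split; intros t s; simpl csum].
  + assert (0 <= A * (Rabs (IZR k) + IZR k ^ 2)) by (apply Rmult_le_pos; lra). lra.
    replace (fcoef F k * character k (t + s) + csum l (fun k => fcoef F k * character k (t + s)%R) - (fcoef F k * character k t + csum l (fun k => fcoef F k * character k t)))%C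
      with (fcoef F k * (character k (t + s)%R - character k t) + (csum l (fun k => fcoef F k * character k (t + s)%R) - csum l (fun k => fcoef F k * character k t)))%C by ring.
    eapply Rle_trans; [apply Cmod_triangle|]. rewrite Cmod_mult. fold A.
    pose proof (character_first_difference k t s) as E. specialize (L1 t s).
    assert (A * Cmod (character k (t + s) - character k t) <= A * ((Rabs (IZR k) + IZR k ^ 2) * Rabs s)).
    { apply Rmult_le_compat_l; [assumption|]. pose proof (Rabs_pos s). nra. }
    lra.
  + replace (fcoef F k * character k (t + s) + csum l (fun k => fcoef F k * character k (t + s)%R) +
       (fcoef F k * character k (t - s) + csum l (fun k => fcoef F k * character k (t - s)%R)) -
       2 * (fcoef F k * character k t + csum l (fun k => fcoef F k * character k t)))%C
      with (fcoef F k * (character k (t + s)%R + character k (t - s)%R - 2 * character k t) + (csum l (fun k => fcoef F k * character k (t + s)%R) +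
        csum l (fun k => fcoef F k * character k (t - s)%R) - 2 * csum l (fun k => fcoef F k * character k t)))%C by ring.
    eapply Rle_trans; [apply Cmod_triangle|]. rewrite Cmod_mult. fold A.
    pose proof (character_second_difference k t s) as E. specialize (L2 t s).
    assert (A * Cmod (character k (t + s) + character k (t - s) - 2 * character k t) <= A * ((Rabs (IZR k) + IZR k ^ 2) * s ^ 2)).
    { apply Rmult_le_compat_l; [assumption|]. pose proof (pow2_ge_0 s). nra. }
    lra.
Qed.

(** The increments need not be opposite: along a curve [P] they are [P (t + s) - P t] and
    [P (t - s) - P t]. The linear terms leave the coefficient times [x + y], which is the second
    difference of [P]. *)
Lemma second_order_sum (phi : C -> C) (z x y : C) (k M : R) : 0 < k -> holo_bd phi z (2 * k) M ->
  Cmod (phi (z + x)%C) <= M -> Cmod (phi (z + y)%C) <= M ->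
  Cmod (phi (z + x)%C + phi (z + y)%C - 2 * phi z) <=
    10 * M / k ^ 2 * (Cmod x ^ 2 + Cmod y ^ 2) + M / k * Cmod (x + y).
Proof.
intros Hk H Hx Hy.
pose proof (second_order phi z x k M Hk H Hx) as Tx. pose proof (second_order phi z y k M Hk H Hy) as Ty.
pose proof (taylor_coef_bound phi z (2 * k) M k 1 H ltac:(lra)) as T. rewrite pow_1 in T.
set (c := taylor_coef phi z k 1) in *.
replace (phi (z + x) + phi (z + y) - 2 * phi z)%C with
  ((phi (z + x) - phi z - c * x) + (phi (z + y) - phi z - c * y) + c * (x + y))%C by ring.
eapply Rle_trans; [apply Cmod_triangle|].
eapply Rle_trans; [apply Rplus_le_compat_r, Cmod_triangle|]. rewrite Cmod_mult.
pose proof (Rmult_le_compat_r (Cmod (x + y)) _ _ (Cmod_ge_0 _) T). lra.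
Qed.

Lemma first_order (phi : C -> C) (z x : C) (k M : R) : 0 < k -> holo_bd phi z (2 * k) M ->
  Cmod (phi (z + x)%C) <= M ->
  Cmod (phi (z + x)%C - phi z) <= 10 * M / k ^ 2 * Cmod x ^ 2 + M / k * Cmod x.
Proof.
intros Hk H Hx.
pose proof (second_order phi z x k M Hk H Hx) as Tx.
pose proof (taylor_coef_bound phi z (2 * k) M k 1 H ltac:(lra)) as T. rewrite pow_1 in T.
set (c := taylor_coef phi z k 1) in *.
replace (phi (z + x) - phi z)%C with ((phi (z + x) - phi z - c * x) + c * x)%C by ring.
eapply Rle_trans; [apply Cmod_triangle|]. rewrite Cmod_mult.
pose proof (Rmult_le_compat_r (Cmod x) _ _ (Cmod_ge_0 _) T). lra.
Qed.

(** Moving the centre translates the whole circle, so differences in [t] are taken inside the mean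
    over [th]; the modulus of the character is 1, whence a bound independent of [k]. Circles of
    radius [2 r] in discs of radius [4 r] leave a disc of radius [2 r] around each of their points,
    as the estimates above require with [k = r]. *)
Lemma wnorm_le_circ_coef (P : R -> C) (phi : C -> C) (r M L : R) : 0 < r -> 0 <= L -> percont P ->
  (forall t, holo_bd phi (P t) (4 * r) M) ->
  (forall t s, Cmod (P (t + s) - P t) <= L * Rabs s) ->
  (forall t s, Cmod (P (t + s) + P (t - s) - 2 * P t) <= L * s ^ 2) ->
  forall k, wnorm_le (fun t => fcoef (circ phi (P t) (2 * r)) k)
    (M + (10 * M / r ^ 2 * (2 * L ^ 2) + M / r * L) * PI ^ 2).
Proof.
intros Hr HL HP H L1 L2 k.
set (K := 10 * M / r ^ 2).
assert (H2 : 0 < 2 * r < 4 * r) by lra.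
assert (Hpc : forall t, percont (circ phi (P t) (2 * r))) by (intros t; apply (percont_circ phi (P t) (4 * r) M); auto; lra).
assert (M0 : 0 <= M) by (eapply Rle_trans; [apply Cmod_ge_0 | apply (fcoef_circ_bound phi (P 0) (4 * r) M (2 * r) 0 (H 0) H2)]).
assert (K0 : 0 <= K) by (apply Rdiv_le_0_compat; [lra | apply pow_lt; lra]).
assert (M1 : 0 <= M / r) by (apply Rdiv_le_0_compat; lra).
set (z := fun t th => (P t + RtoC (2 * r) * expi th)%C).
assert (Hz : forall t th, holo_bd phi (z t th) (2 * r) M).
{ intros t th; apply (holo_bd_sub phi (P t) _ (4 * r)); [apply H|]. unfold z; rewrite circ_dist; lra. }
assert (Hm : forall s t th, (z t th + (P s - P t))%C = z s th) by (intros; unfold z; ring).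
assert (Hb : forall t th, Cmod (phi (z t th)) <= M).
{ intros t th; apply (H t); unfold z; rewrite circ_dist; lra. }
assert (D1 : forall s t th, Cmod (phi (z s th) - phi (z t th)) <= K * Cmod (P s - P t) ^ 2 + M / r * Cmod (P s - P t)).
{ intros s t th. rewrite <- (Hm s t th). apply first_order; auto. rewrite Hm; apply Hb. }
assert (D2 : forall t s th, Cmod (phi (z (t + s) th) + phi (z (t - s) th) - 2 * phi (z t th)) <=
   (K * (2 * L ^ 2) + M / r * L) * s ^ 2).
{ intros t s th. rewrite <- (Hm (t + s) t th), <- (Hm (t - s) t th).
  eapply Rle_trans; [apply (second_order_sum phi (z t th) _ _ r M); auto; rewrite Hm; apply Hb|]. fold K.
  pose proof (L1 t s) as A1. pose proof (L1 t (- s)) as A2. pose proof (L2 t s) as A3.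
  rewrite Rabs_Ropp in A2. fold (t - s) in A2.
  replace (P (t + s)%R - P t + (P (t - s)%R - P t))%C with (P (t + s)%R + P (t - s)%R - 2 * P t)%C by ring.
  assert (B1 : Cmod (P (t + s) - P t) ^ 2 <= (L * Rabs s) ^ 2) by (apply pow_incr; split; [apply Cmod_ge_0 | assumption]).
  assert (B2 : Cmod (P (t - s) - P t) ^ 2 <= (L * Rabs s) ^ 2) by (apply pow_incr; split; [apply Cmod_ge_0 | assumption]).
  rewrite Rpow_mult_distr, RPow_abs, (Rabs_pos_eq (s ^ 2)) in B1, B2 by apply pow2_ge_0.
  apply Rle_trans with (K * (2 * (L ^ 2 * s ^ 2)) + M / r * (L * s ^ 2)).
  - apply Rplus_le_compat; apply Rmult_le_compat_l; lra.
  - right; ring. }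
apply wnorm_le_second_difference.
- split.
  + intros t; apply ccont_eps; intros eps He.
    set (W := K + M / r + 1). assert (HW : 0 < W) by (unfold W; lra).
    set (d := Rmin 1 (eps / 2 / W)).
    assert (Hd : 0 < d) by (apply Rmin_pos; [lra | apply Rdiv_lt_0_compat; lra]).
    destruct (proj1 (ccont_eps P t) (proj1 HP t) d Hd) as [d' [Hd' HPd]].
    exists d'; split; [assumption|]. intros s Hs. specialize (HPd s Hs).
    rewrite <- fcoef_minus by apply Hpc.
    apply Rle_lt_trans with (eps / 2); [|lra].
    apply fcoef_bound; [apply percont_minus; apply Hpc|]. intros th. eapply Rle_trans; [apply D1|].
    assert (E1 : d <= 1) by apply Rmin_l. assert (E2 : d <= eps / 2 / W) by apply Rmin_r.
    set (x := Cmod (P s - P t)) in *. assert (X0 : 0 <= x) by apply Cmod_ge_0.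
    apply Rle_trans with (W * (eps / 2 / W)); [|right; field; lra].
    apply Rle_trans with (W * x); [|apply Rmult_le_compat_l; lra].
    assert (x ^ 2 <= x) by nra. unfold W; nra.
  + intros t. rewrite (proj2 HP). reflexivity.
- apply Rplus_le_le_0_compat; apply Rmult_le_pos; try assumption. pose proof (pow2_ge_0 L); lra.
- intros t; apply (fcoef_circ_bound phi (P t) (4 * r)); auto.
- intros t s. rewrite <- fcoef_plus, <- fcoef_scal, <- fcoef_minus by (try apply percont_plus; try apply percont_scal; apply Hpc).
  apply fcoef_bound; [apply percont_minus; [apply percont_plus | apply percont_scal]; apply Hpc|]. intros th; apply D2.
Qed.

Lemma rsum_half_powers (Q : R) (N m : nat) : 0 <= Q -> rsum (seq m N) (fun k => Q * (/ 2) ^ k) <= 2 * Q * (/ 2) ^ m.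
Proof.
intros HQ; revert m; induction N as [|N IH]; intros m; simpl.
- apply Rmult_le_pos; [lra | apply pow_le; lra].
- specialize (IH (S m)). simpl in IH. lra.
Qed.

Theorem wiener_levy (F : R -> C) (phi : C -> C) (R0 M A : R) : 0 < R0 -> wnorm_le F A ->
  (forall t, holo_bd phi (F t) R0 M) -> exists B, wnorm_le (fun t => phi (F t)) B.
Proof.
intros HR0 HF H.
(* [P t] lies within [r] of [F t], so the disc of radius [4 r] about it needs [5 r <= R0]; 8 leaves
   room. *)
set (r := R0 / 8). assert (Hr : 0 < r) by (unfold r; lra).
destruct (wnorm_le_approx F A r HF Hr) as [l [_ Hg]].
set (P := psum F l) in *. set (g := fun t => (F t - P t)%C) in *.
assert (HP : percont P) by apply percont_psum.
destruct (psum_differences F l) as [L [HL [L1 L2]]]. fold P in L1, L2.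
pose proof (wnorm_le_sup g r Hg) as Hgs.
assert (HPh : forall t, holo_bd phi (P t) (4 * r) M).
{ intros t; apply (holo_bd_sub phi (F t) _ R0); [apply H|].
  specialize (Hgs t). unfold g in Hgs. replace (P t - F t)%C with (- (F t - P t))%C by ring.
  rewrite Cmod_opp. unfold r in *; lra. }
pose proof (wnorm_le_circ_coef P phi r M L Hr HL HP HPh L1 L2) as HC.
set (Q := M + (10 * M / r ^ 2 * (2 * L ^ 2) + M / r * L) * PI ^ 2) in *.
assert (Q0 : 0 <= Q) by exact (wnorm_le_nonneg _ _ (HC 0%Z)).
assert (H2 : 0 < 2 * r < 4 * r) by lra.
assert (M0 : 0 <= M) by (eapply Rle_trans; [apply Cmod_ge_0 | apply (fcoef_circ_bound phi (P 0) (4 * r) M (2 * r) 0 (HPh 0) H2)]).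
assert (HT : forall k, wnorm_le (fun t => taylor_coef phi (P t) (2 * r) k * g t ^ k)%C (Q * (/ 2) ^ k)).
{ intros k. replace (Q * (/ 2) ^ k) with ((Cmod (RtoC (/ (2 * r) ^ k)) * Q) * r ^ k).
  - apply (wnorm_le_mult (fun t => taylor_coef phi (P t) (2 * r) k) (fun t => g t ^ k)%C); [|apply wnorm_le_pow, Hg].
    apply (wnorm_le_ext (fun t => RtoC (/ (2 * r) ^ k) * fcoef (circ phi (P t) (2 * r)) (Z.of_nat k))%C).
    + intros t; unfold taylor_coef; ring.
    + apply (wnorm_le_scal _ (fun t => fcoef (circ phi (P t) (2 * r)) (Z.of_nat k))), HC.
  - rewrite Cmod_R, Rabs_pos_eq by (left; apply Rinv_0_lt_compat, pow_lt; lra).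
    rewrite Rpow_mult_distr, pow_inv. field. split; apply pow_nonzero; lra. }
assert (HFt : forall t, F t = (P t + g t)%C) by (intros t; unfold g; ring).
(* The Taylor sums have Wiener norm at most the sum of [Q 2^-k], that is [2 Q]; it remains to see
   that they converge uniformly. *)
exists (2 * Q). apply wnorm_le_limit.
- split.
  + intros t. destruct (H t (F t)) as [[b Hb] _]; [replace (F t - F t)%C with (RtoC 0) by ring; rewrite Cmod_0; lra|].
    apply (ccont_cderiv phi F t b); [apply HF | exact Hb].
  + intros t; rewrite (proj2 (proj1 HF)); reflexivity.
- intros eps He.
  destruct (pow_lt_1_zero (/ 2) ltac:(rewrite Rabs_pos_eq; lra) (eps / (2 * M + 1))) as [N HN].
  { apply Rdiv_lt_0_compat; lra. }
  (* [S N] terms, since [taylor] asks for at least one. *)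
  specialize (HN (S N) ltac:(lia)). rewrite Rabs_pos_eq in HN by (apply pow_le; lra).
  exists (fun t => csum (seq 0 (S N)) (fun k => taylor_coef phi (P t) (2 * r) k * g t ^ k)%C). split.
  + apply (wnorm_le_weaken _ (rsum (seq 0 (S N)) (fun k => Q * (/ 2) ^ k))).
    * pose proof (rsum_half_powers Q (S N) 0 Q0) as T. rewrite pow_O, Rmult_1_r in T. exact T.
    * apply (wnorm_le_csum (seq 0 (S N)) (fun k t => taylor_coef phi (P t) (2 * r) k * g t ^ k)%C). intros; apply HT.
  + intros t. rewrite (HFt t). specialize (Hgs t). pose proof (Cmod_ge_0 (g t)) as G0.
    eapply Rle_trans; [apply (taylor phi (P t) (g t) (4 * r) M (2 * r) (S N) (HPh t) H2); [lra | lia]|].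
    set (q := Cmod (g t) / (2 * r)).
    assert (Hq : 0 <= q <= / 2).
    { split; [apply Rdiv_le_0_compat; lra|]. apply Rmult_le_reg_r with (2 * r); [lra|]. unfold q; field_simplify; lra. }
    assert (I : / (1 - q) <= 2) by (rewrite <- (Rinv_inv 2); apply Rinv_le_contravar; lra).
    assert (I0 : 0 < / (1 - q)) by (apply Rinv_0_lt_compat; lra).
    assert (J1 : q ^ S N <= (/ 2) ^ S N) by (apply pow_incr; assumption).
    assert (J0 : 0 <= q ^ S N) by (apply pow_le; lra).
    apply Rle_trans with (M * (/ 2) ^ S N * 2).
    * apply Rmult_le_compat; try lra; [apply Rmult_le_pos; assumption | apply Rmult_le_compat_l; assumption].
    * apply Rmult_lt_compat_l with (r := 2 * M + 1) in HN; [|lra].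
      replace ((2 * M + 1) * (eps / (2 * M + 1))) with eps in HN by (field; lra).
      assert (0 <= (/ 2) ^ S N) by (apply pow_le; lra). lra.
Qed.

(** * Weighted summability and the truncated weight *)

Lemma ex_series_bounded (u : nat -> R) (B : R) : (forall n, 0 <= u n) -> (forall N, rsum (seq 0 N) u <= B) -> ex_series u.
Proof.
intros Hu H.
assert (E : forall N, sum_n u N = rsum (seq 0 (S N)) u).
{ induction N as [|N IH]; [rewrite sum_O; simpl; ring|].
  rewrite sum_Sn, IH, (seq_S (S N)), rsum_app. unfold plus; simpl; ring. }
destruct (ex_finite_lim_seq_incr (sum_n u) B) as [x Hx].
- intros n; rewrite sum_Sn. unfold plus; simpl. specialize (Hu (S n)); lra.
- intros n; rewrite E; apply H.
- exists x; exact Hx.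
Qed.

Lemma ex_series_partial_bound (u : nat -> R) : (forall n, 0 <= u n) -> ex_series u -> exists B, forall N, rsum (seq 0 N) u <= B.
Proof.
intros Hu Hs. exists (Series u). intros N.
assert (E : forall N, sum_n u N = rsum (seq 0 (S N)) u).
{ clear N; induction N as [|N IH]; [rewrite sum_O; simpl; ring|].
  rewrite sum_Sn, IH, (seq_S (S N)), rsum_app. unfold plus; simpl; ring. }
apply Rle_trans with (rsum (seq 0 (S N)) u).
- rewrite seq_S, rsum_app; simpl. specialize (Hu N); lra.
- rewrite <- E. apply (is_lim_seq_incr_compare (sum_n u)).
  + apply Series_correct; exact Hs.
  + intros n; rewrite sum_Sn. unfold plus; simpl. specialize (Hu (S n)); lra.
Qed.

Lemma percont_on_circle (f : C -> C) : continuous_on_circle f -> percont (fun t => f (expi t)).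
Proof.
intros H; split; intros t.
- apply ccont_eps; intros eps He.
  destruct (H (expi t) (Cmod_expi t) eps He) as [d [Hd K]].
  destruct (proj1 (ccont_eps expi t) (ccont_expi t) d Hd) as [d' [Hd' K']].
  exists d'; split; [assumption|]. intros s Hs; apply K; [apply Cmod_expi | apply K', Hs].
- rewrite <- (expi_period t 1), Rmult_1_r; reflexivity.
Qed.

Lemma wnorm_le_of_w_abs_conv (w : Z -> R) (f : C -> C) : is_weight w -> continuous_on_circle f -> w_abs_conv w f ->
  exists A, wnorm_le (fun t => f (expi t)) A.
Proof.
intros [Hw _] Hf [H1 H2].
assert (P : forall n, 0 <= Cmod (fourier f n) * w n).
{ intros n; apply Rmult_le_pos; [apply Cmod_ge_0 | specialize (Hw n); lra]. }
apply ex_series_partial_bound in H1 as [B1 K1]; [|intros; apply P].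
apply ex_series_partial_bound in H2 as [B2 K2]; [|intros; apply P].
exists (B1 + B2); split; [apply percont_on_circle; assumption|]. intros l Hl.
change (rsum l (fun n => Cmod (fourier f n)) <= B1 + B2).
apply Rle_trans with (rsum l (fun n => Cmod (fourier f n) * w n)).
- apply rsum_le; intros n _. pose proof (Cmod_ge_0 (fourier f n)); specialize (Hw n); nra.
- apply NoDup_rsum_Z; [exact P | | assumption]. intros N. unfold zseq; rewrite 2!rsum_map.
  apply Rplus_le_compat; [apply K1 | apply K2].
Qed.

Lemma w_abs_conv_of_wnorm_le (w : Z -> R) (K B : R) (f : C -> C) : (forall n, 0 <= w n <= K) ->
  wnorm_le (fun t => f (expi t)) B -> w_abs_conv w f.
Proof.
intros Hw [_ H].
assert (S : forall g : nat -> Z, (forall x y, g x = g y -> x = y) -> ex_series (fun k => Cmod (fourier f (g k)) * w (g k))).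
{ intros g Hg. apply (ex_series_bounded _ (K * B)).
  - intros n; apply Rmult_le_pos; [apply Cmod_ge_0 | apply Hw].
  - intros N. apply Rle_trans with (rsum (seq 0 N) (fun k => K * Cmod (fourier f (g k)))).
    + apply rsum_le; intros k _. rewrite Rmult_comm. apply Rmult_le_compat_r; [apply Cmod_ge_0 | apply Hw].
    + rewrite rsum_scal. apply Rmult_le_compat_l; [specialize (Hw 0%Z); lra|].
      rewrite <- (rsum_map g (seq 0 N) (fun n => Cmod (fourier f n))).
      apply H, NoDup_map_inj; [assumption | apply seq_NoDup]. }
split; [apply (S Z.of_nat) | apply (S (fun k => (- Z.of_nat k)%Z))]; intros; lia.
Qed.

(** If neither factor is truncated, submultiplicativity of [w] applies; otherwise one factor is [K]
    and the other at least 1, so the product is at least [K]. *)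
Lemma is_weight_min (w : Z -> R) (K : R) : 1 <= K -> is_weight w -> is_weight (fun n => Rmin (w n) K).
Proof.
intros HK [H1 H2]; split; [intros n; apply Rmin_glb; auto|].
intros m n. pose proof (H1 m); pose proof (H1 n); pose proof (H2 m n).
pose proof (Rmin_l (w (m + n)%Z) K); pose proof (Rmin_r (w (m + n)%Z) K).
unfold Rmin at 2 3. destruct (Rle_dec (w m) K), (Rle_dec (w n) K); nra.
Qed.

Theorem mainTheorem2 (w : Z -> R) (f phi : C -> C) :
  is_weight w ->
  continuous_on_circle f ->
  w_abs_conv w f ->
  holo_near_range phi f ->
  exists chi : Z -> R,
    is_weight chi /\
    w_abs_conv chi (fun z => phi (f z)) /\
    (nonconstant chi <-> nonconstant w) /\
    (forall n : Z, chi n <= w n).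
Proof.
intros Hw Hf Hwf [U [HU [HfU Hphi]]].
destruct (wnorm_le_of_w_abs_conv w f Hw Hf Hwf) as [A HA].
destruct (uniform_holo_bd (fun t => f (expi t)) phi U (proj1 HA) HU) as [R0 [M [HR0 HM]]].
{ intros t; apply HfU, Cmod_expi. }
{ intros z Hz; apply ex_derive_cderiv, Hphi, Hz. }
destruct (wiener_levy _ phi R0 M A HR0 HA HM) as [B HB].
assert (S : forall K, 1 <= K -> w_abs_conv (fun n => Rmin (w n) K) (fun z => phi (f z))).
{ intros K HK; apply (w_abs_conv_of_wnorm_le _ K B); [|exact HB].
  intros n; split; [|apply Rmin_r]. apply Rmin_glb; [|lra]. pose proof (proj1 Hw n); lra. }
assert (N : exists K, 1 <= K /\ (nonconstant (fun n => Rmin (w n) K) <-> nonconstant w)).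
{ destruct (classic (nonconstant w)) as [[m [n Hmn]]|Hc].
  (* A cap at the larger of two distinct values leaves both unchanged. *)
  - exists (Rmax (w m) (w n)); split; [eapply Rle_trans; [apply (proj1 Hw m) | apply Rmax_l]|].
    split; intros _; exists m, n; [assumption|].
    rewrite !Rmin_left by (apply Rmax_l || apply Rmax_r); assumption.
  - exists 1; split; [lra|]. split; [|contradiction].
    intros [m [n Hmn]]; exists m, n; intros E; apply Hmn; rewrite E; reflexivity. }
destruct N as [K [HK HN]].
exists (fun n => Rmin (w n) K).
split; [apply is_weight_min; assumption|]. split; [apply S, HK|]. split; [exact HN|]. intros n; apply Rmin_l.
Qed.
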